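(* For each integer $n\ge 0$, let $a_n$ denote the number of tilings of a $9\times 8n$ board by $L$-tetrominoes (rotations allowed, reflections not allowed). Then the generating function is $\sum_{n\ge 0}a_nt^n=-A(t)/B(t)$, where both $A(t)$ and $B(t)$ are polynomials of degree $146$. The first terms of the sequence $(a_n)_{n\ge 0}$ are \[1, 114, 42305, 17416144, 7258193991, 3032714594518, 1267783654718834, \ldots \]
   Context: A $k\times n$ board is the rectangle of unit cells $\{(x,y)\in\mathbb{Z}^2: 0\le x<n,\ 0\le y<k\}$, where each cell is named by its bottom left corner. The $L$-tetromino tiles are the translates of the four sets (the rotations of the $L$-tetromino) \[\{(0,0),(0,1),(0,2),(1,0)\},\ \{(0,0),(0,1),(1,1),(2,1)\},\ \{(0,0),(1,0),(2,0),(2,1)\},\ \{(0,2),(1,0),(1,1),(1,2)\}.\] Reflections of these shapes are not allowed. A tiling of a board is a partition of its set of cells into such tiles (each tile may be used any number of times); two tilings are the same only if they are equal as partitions of the board (no identification under symmetries). The empty board ($n=0$) has exactly one tiling. Generating functions are formal power series in $t$ with rational coefficients, and polynomials are polynomials in $t$ with rational coefficients. The polynomials $A$ and $B$ are not specified explicitly; the assertion is that such polynomials exist. *)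

(* Defs.v *)
From mathcomp Require Import all_boot all_order all_algebra.
Set Implicit Arguments.
Unset Strict Implicit.
Unset Printing Implicit Defensive.
Import Order.TTheory GRing.Theory Num.Theory.
Local Open Scope ring_scope.

(* The k x n board: n columns (abscissa x < n) and k rows (ordinate y < k). *)
Definition cell (k n : nat) : finType := ('I_n * 'I_k)%type.

Definition coord (k n : nat) (c : cell k n) : int * int :=
  ((c.1 : nat)%:Z, (c.2 : nat)%:Z).

Definition L_shapes : seq (seq (int * int)) :=
  [:: [:: (0, 0); (0, 1); (0, 2); (1, 0)];
      [:: (0, 0); (0, 1); (1, 1); (2, 1)];
      [:: (0, 0); (1, 0); (2, 0); (2, 1)];
      [:: (0, 2); (1, 0); (1, 1); (1, 2)]].

Definition translate (v : int * int) (S : seq (int * int)) : seq (int * int) :=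
  [seq s + v | s <- S].

(* Both lists are duplicate-free, so [perm_eq] is equality of sets of cells. *)
Definition is_translate (k n : nat) (C : {set cell k n})
    (S : seq (int * int)) (v : int * int) : bool :=
  perm_eq [seq coord c | c <- enum C] (translate v S).

(* Each shape has least abscissa and least ordinate 0, so a translate lying in
   the board has its translation vector in the board; [is_L_tileP] shows that
   bounding the vector in this way loses no tile. *)
Definition is_L_tile (k n : nat) (C : {set cell k n}) : bool :=
  has (fun S => [exists v : cell k n, is_translate C S (coord v)]) L_shapes.

Lemma is_L_tileP (k n : nat) (C : {set cell k n}) :
  reflect (exists S v, S \in L_shapes /\ is_translate C S v) (is_L_tile C).
Proof.
apply: (iffP hasP) => [[S SL /existsP[v Cv]] | [S [[v1 v2] [SL Cv]]]].
  by exists S, (coord v).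
exists S => //; apply/existsP.
have inb s : s \in S -> exists c : cell k n, coord c = s + (v1, v2).
  move=> sS; have: s + (v1, v2) \in [seq coord c | c <- enum C].
    by rewrite (perm_mem Cv); apply: map_f.
  by case/mapP=> c _ ->; exists c.
have [y xS] : exists y, (0, y) \in S.
  by move: SL; rewrite !inE => /or4P[] /eqP->;
    [exists 0 | exists 0 | exists 0 | exists 2]; rewrite !inE.
have [x yS] : exists x, (x, 0) \in S.
  by move: SL; rewrite !inE => /or4P[] /eqP->;
    [exists 0 | exists 0 | exists 0 | exists 1]; rewrite !inE.
have [[cx ?] [ex _]] := inb _ xS; have [[? cy] [_ ey]] := inb _ yS.
exists (cx, cy); suff -> : coord (cx, cy) = (v1, v2) by [].
by rewrite /coord /= ex ey /= !add0r.
Qed.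

Definition L_tilings (k n : nat) : {set {set {set cell k n}}} :=
  [set P | partition P [set: cell k n] & [forall C in P, is_L_tile C]].

Definition num_L_tilings (k n : nat) : nat := #|L_tilings k n|.

(* A formal power series over [rat] is its sequence of coefficients. *)
Definition fps : Type := nat -> rat.

Definition fps_of_poly (p : {poly rat}) : fps := fun n => p`_n.

Definition fps_mul (f g : fps) : fps :=
  fun n => \sum_(i < n.+1) f i * g (n - i)%N.

(* f = P / Q in the ring of formal power series: Q is invertible there, i.e.
   has nonzero constant term, and f is the unique solution of Q f = P. *)
Definition fps_is_quotient (f : fps) (P Q : {poly rat}) : Prop :=
  Q`_0 != 0 /\ fps_mul (fps_of_poly Q) f =1 fps_of_poly P.

(* Main.v *)
(* Cutting the board into columns turns the count into a matrix power
   a_n = (T^n)_{0,0}, where T transfers profiles (partially filled pairs of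
   columns) over 8 columns; only 307 profiles at a cut are both reachable from
   and completable to the empty one.  T has rank 146 from its third power on:
   there are 161 independent vectors k with k T^3 = 0.  The function
   v = T e_0 - n, where n is the nilpotent part of T e_0 and T n = 0, n_0 = 0,
   and all its images T^j v are orthogonal to these k, so v, T v, .., T^146 v
   satisfy a linear relation.  Reading it at the empty profile gives a
   denominator B of degree at most 146 and a numerator A of degree at most 146
   (the relation holds from a_1 on, whence the extra degree of A).

   The degrees are exactly 146 because this already holds modulo 5: the series
   is congruent to P/Q modulo t^293 with P, Q coprime of degree 146 over F_5,
   and any fraction with numerator and denominator of degree at most 146 that
   agrees with P/Q up to t^292 is a scalar multiple of it; B is taken primitive
   so that it does not vanish modulo 5. *)

Require Import Defs.
From Stdlib Require Import NArith ZArith.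
From mathcomp Require Import all_boot all_order all_algebra.
From mathcomp Require Import ssrZ zify ring.
Set Implicit Arguments.
Unset Strict Implicit.
Unset Printing Implicit Defensive.
Import Order.TTheory GRing.Theory Num.Theory.

(** * From tilings to profiles *)

Definition tilings (T : finType) (tile : pred {set T}) (U : {set T}) :=
  [set P | partition P U & [forall C in P, tile C]].

(* Sort the tilings by the tile that covers c. *)
Lemma card_tilings_first (T : finType) (tile : pred {set T}) (U : {set T}) c :
  c \in U ->
  #|tilings tile U| =
  \sum_(C | [&& tile C, c \in C & C \subset U]) #|tilings tile (U :\: C)|.
Proof.
move=> cU; rewrite -sum1_card.
rewrite (partition_big (fun P => pblock P c)
          (fun C => [&& tile C, c \in C & C \subset U])) /=; last first.
  move=> P; rewrite inE => /andP[Ppart /'forall_implyP Ptile].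
  have cP : c \in cover P by rewrite (cover_partition Ppart).
  have BP := pblock_mem cP.
  rewrite Ptile //= mem_pblock cP /= -(cover_partition Ppart).
  exact: (bigcup_sup _ BP).
apply: eq_bigr => C /and3P[Ctile cC CU].
have CN0 : C != set0 by apply/set0Pn; exists c.
have CNQ Q : Q \in tilings tile (U :\: C) -> C \notin Q.
  rewrite inE => /andP[Qpart _]; apply/negP => CQ.
  have : c \in cover Q by apply/bigcupP; exists C.
  by rewrite (cover_partition Qpart) inE cC.
(* The fibre over [C] is the injective image of the tilings of [U :\: C] under adding the block
   [C]. *)
rewrite sum1dep_card -(card_in_imset (f := fun Q => C |: Q)
  (D := mem (tilings tile (U :\: C)))); last first.
  move=> Q Q' Qt Qt' /= eqQ.
  by rewrite -(setU1K (CNQ _ Qt)) eqQ setU1K ?CNQ.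
apply: eq_card => P; rewrite inE; apply/idP/imsetP => [|[Q Qt ->]].
  rewrite inE => /andP[/andP[Ppart Ptile] /eqP PC].
  have CP : C \in P.
    by rewrite -PC pblock_mem // (cover_partition Ppart).
  exists (P :\ C); last by rewrite setD1K.
  rewrite inE partitionD1 //=; apply/'forall_implyP => D /setD1P[_ DP].
  by move/'forall_implyP: Ptile; apply.
have CQ := CNQ _ Qt; move: Qt; rewrite inE => /andP[Qpart /'forall_implyP Qtile].
have CQpart : partition (C |: Q) U.
  rewrite -(setID U C) (setIidPr CU) partitionU1 //.
  by rewrite -setI_eq0 setIDA setDIl setDv set0I.
rewrite inE CQpart /=; apply/andP; split.
  by apply/'forall_implyP => D /setU1P[-> | /Qtile].
apply/eqP; apply: def_pblock => //; first by case/and3P: CQpart.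
by rewrite setU11.
Qed.

(** * Cells and tiles in column-major order *)

Definition idx (n : nat) (c : cell 9 n) : nat := 9 * c.1 + c.2.

Lemma idx_lt n (c : cell 9 n) : idx c < 9 * n.
Proof. by case: c => [[x xn] [y y9]]; rewrite /idx /=; lia. Qed.

Lemma idx_surj n i : i < 9 * n -> {c : cell 9 n | idx c = i & c.2 = i %% 9 :> nat}.
Proof.
move=> i_lt.
have xn : i %/ 9 < n by lia.
have y9 : i %% 9 < 9 by lia.
by exists (Ordinal xn, Ordinal y9); rewrite /idx //=; lia.
Qed.

(* The tiles whose first cell in column-major order lies in row y, given by
   the offsets of their cells in this order (the cell (dx, dy) away from the
   first one has offset 9 dx + dy). *)
Definition offsets (y : nat) : seq (seq nat) :=
  (if y < 7 then [:: [:: 0; 1; 2; 9]] else [::]) ++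
  (if y < 8 then [:: [:: 0; 1; 10; 19]; [:: 0; 9; 18; 19]] else [::]) ++
  (if 1 < y then [:: [:: 0; 7; 8; 9]] else [::]).

(** Offsets that run past the last column name no cell and are silently dropped; hence the side
    condition [i + k < 9 * n] in the lemmas below. Running over the top or bottom of a column is
    excluded by the row tests in [offsets]. *)
Definition place (n i : nat) (o : seq nat) : {set cell 9 n} :=
  [set c | idx c \in [seq i + k | k <- o]].

(** Replaces integer coordinates by natural ones, within reach of [lia]. The bounds come as a
    separate conjunct because the membership condition speaks of cells of the board only and would
    not see a cell of the translate sticking out. *)
Lemma is_translateP k n (C : {set cell k n}) (v : cell k n) (S : seq (nat * nat)) :
  uniq S ->
  reflect ((forall s, s \in S -> s.1 + v.1 < n /\ s.2 + v.2 < k) /\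
           forall c : cell k n, (c \in C) =
             ((c.1 : nat, c.2 : nat) \in [seq (s.1 + v.1, s.2 + v.2) | s <- S]))
    (is_translate C [seq (s.1%:Z, s.2%:Z)%R | s <- S] (Defs.coord v)).
Proof.
move=> uS; set f := fun s : nat * nat => (s.1%:Z, s.2%:Z)%R.
have f_inj : injective f by move=> [a b] [a' b'] [-> ->].
rewrite /is_translate.
have -> : translate (Defs.coord v) (map f S) =
          map f [seq (s.1 + v.1, s.2 + v.2) | s <- S].
  by rewrite /translate -!map_comp; apply: eq_map => -[a b].
have coordE : @Defs.coord k n =1 f \o (fun c : cell k n => (c.1 : nat, c.2 : nat)) by [].
rewrite (eq_map coordE) map_comp.
have -> s t : perm_eq (map f s) (map f t) = perm_eq s t.
  apply/idP/idP => [|/(perm_map f) //].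
  by move/(perm_map_inj f_inj).
have pinj : injective (fun c : cell k n => (c.1 : nat, c.2 : nat)).
  by move=> [a b] [a' b'] [/val_inj -> /val_inj ->].
have u2 : uniq [seq (s.1 + v.1, s.2 + v.2) | s <- S].
  by rewrite map_inj_uniq // => -[a b] [a' b'] [] /addIn -> /addIn ->.
apply: (iffP idP) => [/perm_mem eC | [inb eC]].
  split=> [s sS | c]; last by rewrite -eC (mem_map pinj) mem_enum.
  have : (s.1 + v.1, s.2 + v.2) \in [seq (s.1 + v.1, s.2 + v.2) | s <- S].
    by apply: (map_f (fun s : nat * nat => (s.1 + v.1, s.2 + v.2))).
  by rewrite -eC => /mapP[c _ [-> ->]].
apply: uniq_perm => //; first by rewrite (map_inj_uniq pinj) enum_uniq.
move=> p; apply/idP/idP => [/mapP[c] | /mapP[s sS ->]].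
  by rewrite mem_enum eC => ? ->.
have [xn yk] := inb _ sS.
apply/mapP; exists (Ordinal xn, Ordinal yk) => //.
by rewrite mem_enum eC; apply: (map_f (fun s : nat * nat => (s.1 + v.1, s.2 + v.2))).
Qed.

Definition nat_shapes : seq (seq (nat * nat)) :=
  [:: [:: (0, 0); (0, 1); (0, 2); (1, 0)];
      [:: (0, 0); (0, 1); (1, 1); (2, 1)];
      [:: (0, 0); (1, 0); (2, 0); (2, 1)];
      [:: (0, 2); (1, 0); (1, 1); (1, 2)]].

Lemma L_shapesE :
  L_shapes = [seq [seq (s.1%:Z, s.2%:Z)%R | s <- sh] | sh <- nat_shapes].
Proof. by []. Qed.

Lemma is_L_tile_nat n (C : {set cell 9 n}) :
  reflect (exists sh (v : cell 9 n), [/\ sh \in nat_shapes,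
             forall s, s \in sh -> s.1 + v.1 < n /\ s.2 + v.2 < 9 &
             forall c : cell 9 n, (c \in C) =
               ((c.1 : nat, c.2 : nat) \in [seq (s.1 + v.1, s.2 + v.2) | s <- sh])])
    (is_L_tile C).
Proof.
have uS sh : sh \in nat_shapes -> uniq sh.
  by rewrite !inE => /or4P[] /eqP->.
apply: (iffP hasP) => [[sh0 + /existsP[v]] | [sh [v [shL inb eC]]]].
  rewrite L_shapesE => /mapP[sh shL ->] /is_translateP[]; first exact: uS.
  by move=> inb eC; exists sh, v.
exists [seq (s.1%:Z, s.2%:Z)%R | s <- sh]; first by rewrite L_shapesE map_f.
by apply/existsP; exists v; apply/is_translateP; first exact: uS.
Qed.

Lemma is_L_tile_place n (c0 : cell 9 n) o :
  o \in offsets c0.2 -> all (fun k => idx c0 + k < 9 * n) o ->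
  is_L_tile (place n (idx c0) o).
Proof.
case: c0 => [[x xn] [y y9]]; rewrite /idx /= => oy.
have [sh [v [shL esh]]] : exists sh (v : cell 9 n), sh \in nat_shapes /\
  (all (fun k => 9 * x + y + k < 9 * n) o ->
    (forall s, s \in sh -> s.1 + v.1 < n /\ s.2 + v.2 < 9) /\
    forall c : cell 9 n, (c \in place n (9 * x + y) o) =
      ((c.1 : nat, c.2 : nat) \in [seq (s.1 + v.1, s.2 + v.2) | s <- sh])).
  move: oy; rewrite /offsets !mem_cat => /or3P[].
  - case: ifP => // y7; rewrite !inE => /eqP ->.
    exists (nth [::] nat_shapes 0), (Ordinal xn, Ordinal y9); split=> //=.
    move=> /and5P[? ? ? ? _]; split.
      by move=> s; rewrite !inE => /or4P[] /eqP -> /=; lia.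
    move=> [[a an] [b b9]]; rewrite !inE /idx /= !xpair_eqE.
    by apply/idP/idP; lia.
  - case: ifP => // y8; rewrite !inE => /orP[] /eqP ->.
      exists (nth [::] nat_shapes 1), (Ordinal xn, Ordinal y9); split=> //=.
      move=> /and5P[? ? ? ? _]; split.
        by move=> s; rewrite !inE => /or4P[] /eqP -> /=; lia.
      move=> [[a an] [b b9]]; rewrite !inE /idx /= !xpair_eqE.
      by apply/idP/idP; lia.
    exists (nth [::] nat_shapes 2), (Ordinal xn, Ordinal y9); split=> //=.
    move=> /and5P[? ? ? ? _]; split.
      by move=> s; rewrite !inE => /or4P[] /eqP -> /=; lia.
    move=> [[a an] [b b9]]; rewrite !inE /idx /= !xpair_eqE.
    by apply/idP/idP; lia.
  - case: ifP => // y1; rewrite !inE => /eqP ->.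
    (* The first cell of the fourth shape is (0, 2), so its translation vector lies two rows below
       the first cell. *)
    have y2 : y - 2 < 9 by lia.
    exists (nth [::] nat_shapes 3), (Ordinal xn, Ordinal y2); split=> //=.
    move=> /and5P[? ? ? ? _]; split.
      by move=> s; rewrite !inE => /or4P[] /eqP -> /=; lia.
    move=> [[a an] [b b9]]; rewrite !inE /idx /= !xpair_eqE.
    by apply/idP/idP; lia.
by case/esh=> inb eC; apply/is_L_tile_nat; exists sh, v.
Qed.

(** Minimality of [c0], compared with a few cells of each shape, forces [c0] to be the first cell of
    the shape and so determines the translation; that the other cells stay in rows 0 to 8 gives the
    row tests of [offsets]. *)
Lemma is_L_tile_placed n (C : {set cell 9 n}) (c0 : cell 9 n) :
  is_L_tile C -> c0 \in C -> (forall c, c \in C -> idx c0 <= idx c) ->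
  exists2 o, o \in offsets c0.2 &
    all (fun k => idx c0 + k < 9 * n) o /\ C = place n (idx c0) o.
Proof.
case/is_L_tile_nat=> sh [[[vx vxn] [vy vy9]] [shL inb eC]] c0C c0min.
have inC s : s \in sh ->
    [/\ s.1 + vx < n, s.2 + vy < 9 & idx c0 <= 9 * (s.1 + vx) + (s.2 + vy)].
  move=> ssh; have [xn y9] := inb _ ssh; split=> //.
  apply: (c0min (Ordinal xn, Ordinal y9)).
  by rewrite eC; apply: (map_f (fun s : nat * nat => (s.1 + vx, s.2 + vy))).
move: c0 c0C {c0min} inC => [[x xn] [y y9]]; rewrite eC /idx /= => c0C inC.
have eqC o : (forall a b, a < n -> b < 9 ->
      ((a, b) \in [seq (s.1 + vx, s.2 + vy) | s <- sh]) =
      (9 * a + b \in [seq 9 * x + y + k | k <- o])) ->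
    C = place n (9 * x + y) o.
  by move=> eo; apply/setP => -[[a an] [b b9]]; rewrite eC /= eo // inE.
move: shL c0C inC eqC {inb eC}.
rewrite !inE => /or4P[] /eqP -> c0C inC eqC.
- have [a0 b0 d0] := inC (0, 0) isT; move: a0 b0 d0 => /= a0 b0 d0.
  have [a1 b1 d1] := inC (0, 2) isT; move: a1 b1 d1 => /= a1 b1 d1.
  have [a2 b2 d2] := inC (1, 0) isT; move: a2 b2 d2 => /= a2 b2 d2.
  move: c0C; rewrite !inE !xpair_eqE /= => c0C.
  have [ex ey] : x = vx /\ y = vy by lia.
  exists [:: 0; 1; 2; 9];
    first by rewrite /offsets !mem_cat ifT ?inE ?eqxx ?orbT //; lia.
  split; first by rewrite /=; lia.
  by apply: eqC => a b an b9; rewrite !inE !xpair_eqE /=; apply/idP/idP; lia.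
- have [a0 b0 d0] := inC (0, 0) isT; move: a0 b0 d0 => /= a0 b0 d0.
  have [a1 b1 d1] := inC (0, 1) isT; move: a1 b1 d1 => /= a1 b1 d1.
  have [a2 b2 d2] := inC (2, 1) isT; move: a2 b2 d2 => /= a2 b2 d2.
  move: c0C; rewrite !inE !xpair_eqE /= => c0C.
  have [ex ey] : x = vx /\ y = vy by lia.
  exists [:: 0; 1; 10; 19];
    first by rewrite /offsets !mem_cat [in X in _ || X]ifT ?inE ?eqxx ?orbT //; lia.
  split; first by rewrite /=; lia.
  by apply: eqC => a b an b9; rewrite !inE !xpair_eqE /=; apply/idP/idP; lia.
- have [a0 b0 d0] := inC (0, 0) isT; move: a0 b0 d0 => /= a0 b0 d0.
  have [a1 b1 d1] := inC (2, 0) isT; move: a1 b1 d1 => /= a1 b1 d1.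
  have [a2 b2 d2] := inC (2, 1) isT; move: a2 b2 d2 => /= a2 b2 d2.
  move: c0C; rewrite !inE !xpair_eqE /= => c0C.
  have [ex ey] : x = vx /\ y = vy by lia.
  exists [:: 0; 9; 18; 19];
    first by rewrite /offsets !mem_cat [in X in _ || X]ifT ?inE ?eqxx ?orbT //; lia.
  split; first by rewrite /=; lia.
  by apply: eqC => a b an b9; rewrite !inE !xpair_eqE /=; apply/idP/idP; lia.
- have [a0 b0 d0] := inC (0, 2) isT; move: a0 b0 d0 => /= a0 b0 d0.
  have [a1 b1 d1] := inC (1, 0) isT; move: a1 b1 d1 => /= a1 b1 d1.
  have [a2 b2 d2] := inC (1, 2) isT; move: a2 b2 d2 => /= a2 b2 d2.
  move: c0C; rewrite !inE !xpair_eqE /= => c0C.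
  have [ex ey] : x = vx /\ y = vy + 2 by lia.
  exists [:: 0; 7; 8; 9];
    first by rewrite /offsets !mem_cat [in X in _ || (_ || X)]ifT ?inE ?eqxx ?orbT //; lia.
  split; first by rewrite /=; lia.
  by apply: eqC => a b an b9; rewrite !inE !xpair_eqE /=; apply/idP/idP; lia.
Qed.

(** * Profiles and the count cell by cell *)

(* Bit k of a profile w tells whether the k-th cell, in column-major order, from
   the current one on is already covered; these are the bit masks of [offsets]. *)
Definition masks (y : nat) : seq N :=
  (if y < 7 then [:: 519%num] else [::]) ++
  (if y < 8 then [:: 525315%num; 786945%num] else [::]) ++
  (if 1 < y then [:: 897%num] else [::]).

(** When all earlier cells are covered, a free current cell is the first cell of the tile that
    covers it, so only the masks of its row compete. [N.div2] moves on to the next cell. *)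
Definition cellstep (y : nat) (w : N) : seq N :=
  if N.odd w then [:: N.div2 w]
  else [seq N.div2 (N.lor w m) | m <- masks y & N.eqb (N.land w m) 0].

(** Here [j] counts the cells left; as the board ends with a full column, the current row is read
    off [j] without knowing the length of the board. Tiles may stick out on the right: the test on
    the final profile discards them. *)
Fixpoint fillings (j : nat) (w : N) : nat :=
  if j is j'.+1 then \sum_(v <- cellstep (8 - j' %% 9) w) fillings j' v
  else N.eqb w 0.

Definition bit (w : N) (k : nat) : bool := N.testbit w (N.of_nat k).

Lemma bit0 w : bit w 0 = N.odd w. Proof. exact: N.bit0_odd. Qed.

Lemma bit_div2 w k : bit (N.div2 w) k = bit w k.+1.
Proof. by rewrite /bit N.testbit_div2 Nat2N.inj_succ. Qed.

Lemma bit_lor w m k : bit (N.lor w m) k = bit w k || bit m k.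
Proof. exact: N.lor_spec. Qed.

Lemma eq0_bitP w : reflect (forall k, ~~ bit w k) (N.eqb w 0).
Proof.
apply: (iffP idP) => [/N.eqb_eq -> k | w0]; first by [].
apply/N.eqb_eq/N.bits_inj_0 => k.
by rewrite -(N2Nat.id k); apply/negbTE/w0.
Qed.

Definition mask (o : seq nat) : N :=
  foldr (fun k m => N.setbit m (N.of_nat k)) 0%num o.

Lemma bit_mask o k : bit (mask o) k = (k \in o).
Proof.
elim: o => [|i o IHo] /=; first by [].
rewrite /bit N.setbit_eqb -[X in _ || X]/(bit (mask o) k) IHo inE.
by congr (_ || _); lia.
Qed.

Lemma masksE y : masks y = map mask (offsets y).
Proof. by rewrite /masks /offsets; do 3!case: ifP => _. Qed.

Lemma bit_cellstep y w v k : v \in cellstep y w -> bit w k.+1 -> bit v k.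
Proof.
rewrite /cellstep; case: ifP => _; first by rewrite inE => /eqP ->; rewrite bit_div2.
by case/mapP=> m _ ->; rewrite bit_div2 bit_lor => ->.
Qed.

(** A covered cell beyond the end is only shifted, never cleared, so the final profile is
    nonzero. *)
Lemma fillings_overflow j w k : j <= k -> bit w k -> fillings j w = 0.
Proof.
elim: j w k => [|j IHj] w k jk wk /=.
  by case: eq0_bitP => // w0; rewrite (negbTE (w0 k)) in wk.
rewrite big_seq big1 // => v vw.
case: k jk wk => // k jk wk.
exact: (IHj v k jk (bit_cellstep vw wk)).
Qed.

Definition free (n j : nat) (w : N) : {set cell 9 n} :=
  [set c | (9 * n - j <= idx c) && ~~ bit w (idx c - (9 * n - j))].

(** Since [o] stays in the board, equality of the placed sets gives the inclusion of [o] in [o'],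
    and none of the four offset lists is contained in another. *)
Lemma place_inj n i (o o' : seq nat) y : o \in offsets y -> o' \in offsets y ->
  all (fun k => i + k < 9 * n) o -> place n i o = place n i o' -> o = o'.
Proof.
move=> oy oy' /allP o_in eo.
have oo' : all (mem o') o.
  apply/allP => k ko; have [c ic _] := idx_surj (o_in k ko).
  have : c \in place n i o by rewrite inE ic (map_f (addn i)).
  by rewrite eo inE ic (mem_map (@addnI i)).
have sub : all (mem [:: [:: 0; 1; 2; 9]; [:: 0; 1; 10; 19];
                      [:: 0; 9; 18; 19]; [:: 0; 7; 8; 9]]) (offsets y).
  by rewrite /offsets; do 3!case: ifP => _.
move: (allP sub _ oy) (allP sub _ oy') oo'; rewrite !inE.
by do 2![case/or4P => /eqP ->].
Qed.

(** Induction over the cells in order: a covered cell leaves the free region unchanged, and at a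
    free cell the tilings are sorted by the tile covering it with [card_tilings_first]. *)
Lemma fillingsE n j w : j <= 9 * n -> (forall k, j <= k -> ~~ bit w k) ->
  fillings j w = #|tilings (@is_L_tile 9 n) (free n j w)|.
Proof.
elim: j w => [|j IHj] w jn wj.
  have w0 : N.eqb w 0 by apply/eq0_bitP => k; apply: wj.
  rewrite /= w0.
  have -> : free n 0 w = set0.
    by apply/setP => c; rewrite !inE subn0 leqNgt idx_lt.
  rewrite (_ : tilings _ _ = [set set0]) ?cards1 //.
  apply/setP => P; rewrite !inE partition_set0; case: eqP => // ->.
  by apply/'forall_implyP => D; rewrite inE.
rewrite [LHS]/= /cellstep -bit0.
set i := 9 * n - j.+1.
have i_lt : i < 9 * n by rewrite /i; lia.
have [c0 ic0 yc0] := idx_surj i_lt.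
have yE : i %% 9 = 8 - j %% 9 by rewrite /i; lia.
case: ifPn => w0.
  rewrite big_seq1 IHj; [|lia|by move=> k jk; rewrite bit_div2 wj].
  congr #|tilings _ _|; apply/setP => c; rewrite !inE -/i bit_div2.
  have [lt | eq | gt] := ltngtP (idx c) i; first lia.
    have -> : 9 * n - j = i.+1 by rewrite /i; lia.
    by rewrite eq -subSn // subSS; lia.
  have -> : idx c = i by [].
  by rewrite subnn w0; lia.
have c0f : c0 \in free n j.+1 w by rewrite inE -/i ic0 leqnn subnn.
rewrite (card_tilings_first _ c0f) big_map -{}yE.
set y := i %% 9 in yc0 *; set U := free n j.+1 w in c0f *.
have inU c : (c \in U) = (i <= idx c) && ~~ bit w (idx c - i) by rewrite inE.
have land0 o : N.eqb (N.land w (mask o)) 0 = all (fun k => ~~ bit w k) o.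
  apply/eq0_bitP/allP => [wo k ko | wo k].
    by have := wo k; rewrite [bit _ _]N.land_spec -[N.testbit (mask o) _]/(bit _ _)
      bit_mask ko andbT.
  rewrite [bit _ _]N.land_spec -[N.testbit (mask o) _]/(bit _ _) bit_mask.
  by apply/nandP; case: (boolP (k \in o)) => [/wo | _]; [left | right].
have o0 : all (fun o => 0 \in o) (offsets y).
  by rewrite /offsets; do 3!case: ifP.
pose inb o := all (fun k => i + k < 9 * n) o.
(* The tiles that may cover [c0]. The list is duplicate-free, so the sum over sets becomes a sum
   over offset lists. *)
pose r := [seq place n i o | o <- offsets y & all (fun k => ~~ bit w k) o && inb o].
have r_uniq : uniq r.
  rewrite map_inj_in_uniq; first by rewrite filter_uniq // /offsets; do 3!case: ifP.
  move=> o o'; rewrite !mem_filter => /andP[/andP[_ oi] oy] /andP[_ o'y].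
  exact: place_inj oy o'y oi.
have mem_r C : [&& is_L_tile C, c0 \in C & C \subset U] = (C \in r).
  apply/and3P/mapP => [[Ct Cc0 /subsetP CU] | [o]].
    have c0min c : c \in C -> idx c0 <= idx c.
      by move/CU; rewrite inU ic0 => /andP[].
    have [o] := is_L_tile_placed Ct Cc0 c0min.
    rewrite yc0 ic0 => oy [oi eC]; exists o => //.
    rewrite mem_filter oy /inb oi !andbT; apply/allP => k ko.
    have [c ic _] := idx_surj (allP oi _ ko).
    have : c \in C by rewrite eC inE ic map_f.
    by move/CU; rewrite inU ic addKn => /andP[].
  rewrite mem_filter => /andP[/andP[ow oi] oy] ->; split.
  - by rewrite -ic0 is_L_tile_place ?yc0 ?ic0.
  - by rewrite inE ic0; apply/mapP; exists 0; rewrite ?addn0 ?(allP o0).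
  apply/subsetP => c; rewrite inU inE => /mapP[k ko ->].
  by rewrite leq_addr addKn (allP ow).
rewrite (eq_bigl _ _ mem_r) -big_uniq // /r [RHS]big_map [RHS]big_filter.
rewrite big_filter masksE big_map big_mkcond [RHS]big_mkcond /=.
apply: eq_big_seq => o oy; rewrite land0; case: ifP => //= ow.
have b_lor k : bit (N.div2 (N.lor w (mask o))) k = bit w k.+1 || (k.+1 \in o).
  by rewrite bit_div2 bit_lor bit_mask.
(* [cellstep] also tries masks that leave the board; these contribute 0 by overflow. The offending
   offset is positive because cell [i] itself is in the board. *)
case: ifPn => [oi | /allPn[k ko]]; last first.
  rewrite -leqNgt => ik; case: k => [|k] in ko ik *; first lia.
  by apply: (@fillings_overflow _ _ k); [lia | rewrite b_lor ko orbT].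
rewrite IHj; [|lia|]; last first.
  move=> k jk; rewrite b_lor negb_or wj ?ltnS //=; apply/negP => /(allP oi).
  lia.
congr #|pred_of_set (tilings _ _)|; apply/setP => c.
rewrite in_setD inU !inE b_lor.
have -> : 9 * n - j = i.+1 by rewrite /i; lia.
have [lt | gt | ->] := ltngtP (idx c) i; first by rewrite andbF.
  have -> : (idx c \in [seq i + k | k <- o]) = ((idx c - i.+1).+1 \in o).
    rewrite -[RHS](mem_map (@addnI i)) (_ : i + (idx c - i.+1).+1 = idx c) //.
    by lia.
  have -> : (idx c - i.+1).+1 = idx c - i by lia.
  by rewrite ?gt ?(ltnW gt) negb_or /= andbC.
have -> : (i \in [seq i + k | k <- o]) = (0 \in o).
  by rewrite -[RHS](mem_map (@addnI i)) addn0.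
by rewrite (allP o0).
Qed.

(** * Transfer by whole columns *)

Definition completions (c : nat) (w : N) : nat := fillings (9 * c) w.

Lemma completions0 w : completions 0 w = N.eqb w 0.
Proof. by []. Qed.

Lemma num_L_tilingsE n : num_L_tilings 9 n = completions n 0.
Proof.
rewrite /completions (fillingsE (n := n)) //; congr #|pred_of_set (tilings _ _)|.
by apply/setP => c; rewrite !inE subnn.
Qed.

(** The list carries multiplicities: a profile occurs once for each way of filling the column that
    leads to it. *)
Definition colstep (w : N) : seq N :=
  foldl (fun s y => flatten (map (cellstep y) s)) [:: w] (iota 0 9).

Lemma completionsS c w :
  completions c.+1 w = \sum_(v <- colstep w) completions c v.
Proof.
have step k s : k < 9 -> \sum_(v <- s) fillings (9 * c + k.+1) v =
    \sum_(v <- flatten (map (cellstep (8 - k)) s)) fillings (9 * c + k) v.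
  move=> k9; rewrite big_flatten big_map addnS /=.
  by rewrite mulnC modnMDl modn_small.
have -> : completions c.+1 w = \sum_(v <- [:: w]) fillings (9 * c + 9) v.
  by rewrite big_seq1 /completions -mulnSr.
by rewrite !step // addn0.
Qed.
Local Open Scope ring_scope.
Delimit Scope Z_scope with BZ.

(** * The transfer operator *)

Local Opaque colstep completions.

(** The empty profile is excluded at every stage since the board may end there with success; the
    verdict thus holds for any number of columns left. *)
Fixpoint dies (d : nat) (w : N) : bool :=
  if d is d.+1 then ~~ N.eqb w 0 && all (dies d) (colstep w) else false.

Lemma dies_completions d w c : dies d w -> completions c w = 0%N.
Proof.
elim: d w c => [//|d IHd] w c /andP[w0 /allP dw].
case: c => [|c]; first by rewrite completions0 (negbTE w0).
by rewrite completionsS big_seq big1 // => v /dw; apply: IHd.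
Qed.

(* Every reachable profile that cannot be completed is stuck within 10 columns. *)
Definition dead (w : N) : bool := dies 10 w.

Lemma dead_completions w c : dead w -> completions c w = 0%N.
Proof. exact: dies_completions. Qed.

Local Opaque dead.

(** * Binary tries for computation *)

Inductive tree (A : Type) : Type :=
| Leaf
| Node of tree A & option A & tree A.
Arguments Leaf {A}.

Fixpoint tget A (t : tree A) (k : positive) : option A :=
  match t, k with
  | Leaf, _ => None
  | Node _ o _, xH => o
  | Node l _ _, xO k => tget l k
  | Node _ _ r, xI k => tget r k
  end.

Fixpoint tupd A (f : option A -> option A) (k : positive) (t : tree A) : tree A :=
  match k, t with
  | xH, Leaf => Node Leaf (f None) Leaf
  | xO k, Leaf => Node (tupd f k Leaf) None Leaf
  | xI k, Leaf => Node Leaf None (tupd f k Leaf)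
  | xH, Node l o r => Node l (f o) r
  | xO k, Node l o r => Node (tupd f k l) o r
  | xI k, Node l o r => Node l o (tupd f k r)
  end.

Fixpoint tmap A B (f : A -> B) (t : tree A) : tree B :=
  if t is Node l o r then Node (tmap f l) (omap f o) (tmap f r) else Leaf.

Fixpoint tall A (f : A -> bool) (t : tree A) : bool :=
  if t is Node l o r then (if o is Some a then f a else true) && (tall f l && tall f r)
  else true.

Fixpoint tkeys A (f : positive -> bool) (t : tree A) : bool :=
  if t is Node l o r then
    (if o is Some _ then f xH else true) && (tkeys (f \o xO) l && tkeys (f \o xI) r)
  else true.

Lemma tget_map A B (f : A -> B) t k : tget (tmap f t) k = omap f (tget t k).
Proof. by elim: t k => [|l IHl o r IHr] [k|k|] /=. Qed.

Lemma tallP A (f : A -> bool) t k a : tall f t -> tget t k = Some a -> f a.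
Proof.
elim: t k => [|l IHl o r IHr] [k|k|] //= /and3P[fo fl fr]; [exact: IHr|exact: IHl|].
by move=> eo; rewrite eo in fo.
Qed.

Lemma tkeysP A f (t : tree A) k a : tkeys f t -> tget t k = Some a -> f k.
Proof.
elim: t f k => [|l IHl o r IHr] f [k|k|] //= /and3P[fo fl fr].
- exact: IHr fr.
- exact: IHl fl.
- by move=> eo; rewrite eo in fo.
Qed.

(** * Live profiles and their transition tables *)

(* Nothing is proved about the search that produces the live profiles and the
   tables: [tables_ok] validates its result. *)
Definition addset (w : N) (p : tree unit * seq N) :=
  if tget p.1 (N.succ_pos w) is Some _ then p
  else (tupd (fun _ => Some tt) (N.succ_pos w) p.1, w :: p.2).

(** Breadth-first search by columns. The list of levels rotates by one at each column, so after a
    multiple of 8 steps level 0 is at the head again. *)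
Fixpoint reach (fuel : nat) (front : seq N) (ls : seq (tree unit * seq N)) :=
  match fuel, ls with
  | fuel.+1, p :: ls =>
    let p' := foldr addset p front in
    let new := take (size p'.2 - size p.2) p'.2 in
    reach fuel (flatten (map colstep new)) (rcons ls p')
  | _, _ => ls
  end.

Definition prune (ls : seq (tree unit * seq N)) :=
  [seq let alive := [seq w <- pq.1.2 |
                      has (fun v => isSome (tget pq.2.1 (N.succ_pos v))) (colstep w)] in
       (foldr (fun w => tupd (fun _ => Some tt) (N.succ_pos w)) Leaf alive, alive)
  | pq <- zip ls (rot 1 ls)].

(* At each level (number of filled columns modulo 8); the empty profile comes
   first, so its identifier at level 0 is 1. *)
Definition live_states : seq (seq N) := Eval vm_compute in
  [seq rev p.2 | p <- iter 10 prune (reach 64 [:: 0%num] (nseq 8 (Leaf, [::])))].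

Definition table := tree (N * seq positive).

Definition ids (s : seq N) : seq positive := [seq Pos.of_succ_nat i | i <- iota 0 (size s)].

Definition make_table (p : seq N * seq N) : table :=
  let index := foldr (fun wi => tupd (fun _ => Some wi.2) (N.succ_pos wi.1)) Leaf
                     (zip p.2 (ids p.2)) in
  foldr (fun wi => tupd (fun _ => Some (wi.1,
           pmap (fun v => tget index (N.succ_pos v)) (colstep wi.1))) wi.2)
        Leaf (zip p.1 (ids p.1)).

Definition tables : seq table := Eval vm_compute in
  map make_table (zip live_states (rot 1 live_states)).

Local Opaque tables.

Definition tabl (l : nat) : table := nth Leaf tables (l %% 8).

(** [make_table] keeps successors in the order of [colstep], so one simultaneous pass suffices: each
    profile either is the one named by the next identifier or has to be dead. *)
Fixpoint matches (next : table) (vs : seq N) (js : seq positive) : bool :=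
  match vs, js with
  | [::], _ => nilp js
  | v :: vs, [::] => dead v && matches next vs [::]
  | v :: vs, j :: js' =>
    if (if tget next j is Some a then N.eqb a.1 v else false)
    then matches next vs js' else dead v && matches next vs js
  end.

Definition tables_ok : bool :=
  all (fun l => tall (fun a => matches (tabl l.+1) (colstep a.1) a.2) (tabl l)) (iota 0 8).

Lemma tables_okT : tables_ok = true.
Proof. vm_cast_no_check (erefl true). Qed.

Definition compl (l c : nat) (i : positive) : nat :=
  if tget (tabl l) i is Some a then completions c a.1 else 0.

Lemma matches_sum l vs js c : matches (tabl l) vs js ->
  (\sum_(v <- vs) completions c v = \sum_(j <- js) compl l c j)%N.
Proof.
elim: vs js => [|v vs IHvs] [|j js] //=; rewrite ?big_nil //.
  by move=> /andP[dv /IHvs e]; rewrite big_cons e big_nil (dead_completions _ dv).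
case: ifP => [|_ /andP[dv /IHvs e]]; last first.
  by rewrite big_cons e (dead_completions _ dv).
case ei: (tget _ _) => [a|//] /N.eqb_eq av /IHvs e.
by rewrite !big_cons e /compl ei av.
Qed.

Definition transfer (R : nmodType) (tb : table) (f : positive -> R) (i : positive) : R :=
  if tget tb i is Some a then \sum_(j <- a.2) f j else 0.

(** The successors missing from the tables are dead and have no completion, so the recursion of
    [completionsS] survives the restriction to identifiers. *)
Lemma transfer_compl l c : transfer (tabl l) (compl l.+1 c) =1 compl l c.+1.
Proof.
move=> i; rewrite /transfer {2}/compl; case ei: (tget _ _) => [a|//].
rewrite completionsS; apply/esym/matches_sum.
have /allP/(_ (l %% 8)%N) := tables_okT; rewrite mem_iota ltn_mod => /(_ isT) ok.
have ei' : tget (tabl (l %% 8)) i = Some a by rewrite /tabl modn_mod.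
by have := tallP ok ei'; rewrite /tabl -addn1 modnDml addn1.
Qed.

Lemma eq_pullf (R : nmodType) tb (f g : positive -> R) :
  f =1 g -> transfer tb f =1 transfer tb g.
Proof. by move=> fg i; rewrite /transfer; case: tget => // a; apply: eq_bigr. Qed.

Lemma transfer_natr (R : pzSemiRingType) tb (f : positive -> nat) i :
  transfer tb (fun j => (f j)%:R : R) i = (transfer tb f i)%:R.
Proof. by rewrite /transfer; case: tget => // a; rewrite natr_sum. Qed.

Lemma transfer_raddf (R V : nmodType) (h : {additive R -> V}) tb f i :
  transfer tb (h \o f) i = h (transfer tb f i).
Proof. by rewrite /transfer; case: tget => [a|]; rewrite ?raddf0 ?raddf_sum. Qed.

Lemma transfer_lincomb (R : comPzRingType) n tb (c : 'I_n -> R) F i :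
  transfer tb (fun i => \sum_j c j * F j i) i = \sum_j c j * transfer tb (F j) i.
Proof.
rewrite /transfer; case: tget => [a|]; last by rewrite big1 // => j; rewrite mulr0.
by rewrite exchange_big; apply: eq_bigr => j _; rewrite mulr_sumr.
Qed.

(** [f] lives at the end of the block, and [foldr] pulls it back through level 7 first and level 0
    last. *)
Definition transfer_block (R : nmodType) (f : positive -> R) : positive -> R :=
  foldr (fun l => transfer (tabl l)) f (iota 0 8).

Lemma eq_pullf_block (R : nmodType) (f g : positive -> R) :
  f =1 g -> transfer_block f =1 transfer_block g.
Proof.
by rewrite /transfer_block; elim: (iota 0 8) => //= l s IHs /IHs; apply: eq_pullf.
Qed.

Lemma transfer_block_compl (R : pzSemiRingType) c i :
  transfer_block (fun i => (compl 0 c i)%:R : R) i = (compl 0 (8 + c) i)%:R.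
Proof.
have pull_iota m n j : foldr (fun l => transfer (tabl l))
    (fun i => (compl (m + n) c i)%:R : R) (iota m n) j = (compl m (n + c) j)%:R.
  elim: n m j => [|n IHn] m j; first by rewrite addn0.
  rewrite /= addnS -addSn (eq_pullf _ (IHn m.+1)) transfer_natr.
  by rewrite transfer_compl.
(* Levels 8 and 0 have convertible tables, which closes the cycle. *)
exact: (pull_iota 0 8).
Qed.

Lemma transfer_block_lincomb (R : comPzRingType) n (c : 'I_n -> R) F i :
  transfer_block (fun i => \sum_j c j * F j i) i = \sum_j c j * transfer_block (F j) i.
Proof.
rewrite /transfer_block; elim: (iota 0 8) i => //= l s IHs i.
by rewrite (eq_pullf _ IHs) transfer_lincomb.
Qed.

Lemma transfer_block_raddf (R V : nmodType) (h : {additive R -> V}) f i :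
  transfer_block (h \o f) i = h (transfer_block f i).
Proof.
rewrite /transfer_block; elim: (iota 0 8) i => //= l s IHs i.
by rewrite (eq_pullf _ IHs) transfer_raddf.
Qed.

(** * Evaluation of the counts *)

Definition zget (g : tree Z) (i : positive) : Z := odflt Z0 (tget g i).

Definition pull (g : tree Z) (tb : table) : tree Z :=
  tmap (fun a => foldr (fun i => Z.add (zget g i)) Z0 a.2) tb.

Definition pull_block (g : tree Z) : tree Z :=
  foldr (fun l g => pull g (tabl l)) g (iota 0 8).

Lemma zget_pull_block g i : zget (pull_block g) i = transfer_block (zget g) i.
Proof.
rewrite /pull_block /transfer_block; elim: (iota 0 8) i => //= l s IHs i.
rewrite -(eq_pullf _ IHs) /transfer {1}/zget /pull tget_map; case: tget => //= a.
by elim: a.2 => [|j js IHjs]; rewrite ?big_nil ?big_cons //= IHjs.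
Qed.

Fixpoint vals (red : Z -> Z) (n : nat) (g : tree Z) : seq Z :=
  if n is n.+1 then zget g 1 :: vals red n (tmap red (pull_block g)) else [::].

Definition start : tree Z :=
  tmap (fun a => if N.eqb a.1 0 then Zpos 1 else Z0) (tabl 0).

Lemma compl_empty c : compl 0 c 1 = completions c 0.
Proof.
have: omap fst (tget (tabl 0) 1) = Some N0 by vm_cast_no_check (erefl (Some N0)).
by rewrite /compl; case: tget => //= a [->].
Qed.

(** Serves both the exact values, with identities for [h] and [red], and the values modulo 5. The
    transfer is additive, so reducing after each block is invisible to [h]. *)
Lemma valsE (R : pzSemiRingType) (h : {additive Z -> R}) red n :
  h 1 = 1 -> (forall z, h (red z) = h z) ->
  map h (vals red n start) = [seq (num_L_tilings 9 (8 * k))%:R | k <- iota 0 n].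
Proof.
move=> h1 h_red.
have valsE_from c g : (forall i, h (zget g i) = (compl 0 (8 * c) i)%:R) ->
    map h (vals red n g) = [seq (num_L_tilings 9 (8 * k))%:R | k <- iota c n].
  elim: n c g => //= n IHn c g gc; rewrite gc compl_empty -num_L_tilingsE.
  congr cons; apply: IHn => i; rewrite mulnS -transfer_block_compl.
  rewrite -(eq_pullf_block gc) [RHS]transfer_block_raddf -zget_pull_block.
  by rewrite /zget tget_map; case: tget => //=.
apply: valsE_from => i; rewrite /zget /start tget_map /compl muln0.
by case: tget => [a|] /=; rewrite ?raddf0 // completions0; case: ifP; rewrite ?raddf0.
Qed.

(** * Linear dependence of the numbers of completions *)

Fixpoint dot (f : positive -> Z) (t : tree Z) : Z :=
  if t is Node l o r then
    Z.add (if o is Some c then Z.mul c (f xH) else Z0)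
          (Z.add (dot (f \o xO) l) (dot (f \o xI) r))
  else Z0.

Arguments dot f t : simpl never.

Lemma dot_node f l o r : dot f (Node l o r) =
  (if o is Some c then c * f xH else 0) + (dot (f \o xO) l + dot (f \o xI) r).
Proof. by []. Qed.

Lemma dot_leaf f : dot f Leaf = 0. Proof. by []. Qed.

Lemma eq_dot f g t : f =1 g -> dot f t = dot g t.
Proof.
elim: t f g => // l IHl o r IHr f g fg; rewrite !dot_node fg.
by rewrite (IHl _ (g \o xO)) ?(IHr _ (g \o xI)) // => i; apply: fg.
Qed.

(** An entry that cancels is removed, so that [tempty] can recognise a vector that has vanished. *)
Definition tadd (i : positive) (c : Z) (t : tree Z) : tree Z :=
  tupd (fun o => if o is Some x then
                   let y := Z.add x c in if Z.eqb y Z0 then None else Some y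
                 else Some c) i t.

Lemma dot_tadd f i c t : dot f (tadd i c t) = c * f i + dot f t.
Proof.
elim: i f t => [i IHi|i IHi|] f [|l o r]; rewrite /tadd /= -/(tadd _ _ _) !dot_node ?IHi /=
  ?dot_leaf; try by ring.
case: o => [x|]; last by ring.
case: Z.eqb_spec => [xc|_].
  have -> : x = - c by apply/eqP; rewrite -addr_eq0; apply/eqP.
  by ring.
have -> : Z.add x c = x + c by [].
by ring.
Qed.

Fixpoint push (tb : table) (t acc : tree Z) : tree Z :=
  match t, tb with
  | Node l o r, Node l' o' r' =>
    push l' l (push r' r
      match o, o' with
      | Some c, Some a => foldr (fun i => tadd i c) acc a.2
      | _, _ => acc
      end)
  | _, _ => acc
  end.

(** Says that [push] is the transpose of [transfer]: a linear form is pushed forward instead of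
    pulling back a function. *)
Lemma dot_push f tb t acc : dot f (push tb t acc) = dot (transfer tb f) t + dot f acc.
Proof.
have dot0 g u : (forall i, g i = 0) -> dot g u = 0.
  elim: u g => // l IHl o r IHr g g0; rewrite dot_node IHl => [|i]; last exact: g0.
  rewrite IHr => [|i]; last exact: g0.
  by case: o => [c|]; rewrite ?g0 ?mulr0 !addr0.
elim: t tb acc => [|l IHl o r IHr] [|l' o' r'] acc;
  rewrite ?dot_leaf ?add0r //; first by rewrite [dot (transfer _ _) _]dot0 ?add0r.
rewrite dot_node /=.
rewrite IHl IHr.
have -> : dot (transfer (Node l' o' r') f \o xO) l = dot (transfer l' f) l by [].
have -> : dot (transfer (Node l' o' r') f \o xI) r = dot (transfer r' f) r by [].
case: o => [c|]; last by ring.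
have -> : transfer (Node l' o' r') f xH = if o' is Some a then \sum_(j <- a.2) f j else 0.
  by [].
case: o' => [a|]; last by ring.
have -> : dot f (foldr (fun i => tadd i c) acc a.2) = c * (\sum_(j <- a.2) f j) + dot f acc.
  elim: a.2 => [|j s IHs] /=; rewrite ?big_nil ?big_cons ?mulr0 ?add0r //.
  by rewrite dot_tadd IHs; ring.
by ring.
Qed.

Fixpoint tempty (t : tree Z) : bool :=
  match t with
  | Leaf => true
  | Node l None r => tempty l && tempty r
  | _ => false
  end.

Lemma dot_empty f t : tempty t -> dot f t = 0.
Proof.
elim: t f => // l IHl [c|] r IHr f //= /andP[el er].
by rewrite dot_node IHl // IHr.
Qed.

Definition empty_weight (l : nat) (t : tree Z) : Z :=
  dot (fun i => if tget (tabl l) i is Some a then if N.eqb a.1 0 then Zpos 1 else Z0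
                else Z0) t.

Definition zcompl (l c : nat) (i : positive) : Z := (compl l c i)%:R.

Lemma empty_weightE l t : empty_weight l t = dot (zcompl l 0) t.
Proof.
apply: eq_dot => i; rewrite /zcompl /compl; case: tget => // a.
by rewrite completions0; case: ifP.
Qed.

Lemma dot_push_compl l c t : dot (zcompl l.+1 c) (push (tabl l) t Leaf) = dot (zcompl l c.+1) t.
Proof.
rewrite dot_push dot_leaf addr0; apply: eq_dot => i.
by rewrite /zcompl transfer_natr transfer_compl.
Qed.

Fixpoint kill (fuel l : nat) (t : tree Z) : bool :=
  tempty t || if fuel is fuel.+1 then
    let t' := push (tabl l) t Leaf in
    Z.eqb (empty_weight l.+1 t') Z0 && kill fuel l.+1 t'
  else false.

(** The pairing with the counts for c columns is the weight of the empty profile after c pushes: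
    either [kill] has tested it or the vector has vanished before. [kill] does not test the weight
    of [t] itself, whence [c.+1]. *)
Lemma kill_compl fuel l t c : kill fuel l t -> dot (zcompl l c.+1) t = 0.
Proof.
elim: fuel l t c => [|fuel IH] l t c /= /orP[] => [/dot_empty -> // | // | /dot_empty -> // |].
case/andP=> /Z.eqb_eq w0 kt; rewrite -dot_push_compl.
case: c => [|c]; first by rewrite -empty_weightE.
exact: IH.
Qed.

Definition lincomb := seq (positive * Z).

Definition rdot (f : positive -> Z) (r : lincomb) : Z :=
  foldr (fun e x => Z.add (Z.mul e.2 (f e.1)) x) Z0 r.

Definition tree_of (r : lincomb) : tree Z := foldr (fun e => tadd e.1 e.2) Leaf r.

Lemma dot_tree_of f r : dot f (tree_of r) = rdot f r.
Proof. by elim: r => //= e r IHr; rewrite dot_tadd IHr. Qed.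

Definition push_block (t : tree Z) : tree Z :=
  foldl (fun t l => push (tabl l) t Leaf) t (iota 0 8).

Lemma dot_push_block c t :
  dot (zcompl 0 c) (push_block t) = dot (zcompl 0 (8 + c)) t.
Proof.
have push_iota m n u : dot (zcompl (m + n) c)
    (foldl (fun t l => push (tabl l) t Leaf) u (iota m n)) = dot (zcompl m (n + c)) u.
  elim: n m u => [|n IHn] m u; first by rewrite addn0.
  by rewrite /= addnS -addSn IHn dot_push_compl.
exact: (push_iota 0 8).
Qed.

Fixpoint entries (s : seq Z) : lincomb :=
  if s is i :: c :: s then (Z.to_pos i, c) :: entries s else [::].

(* A basis of the integer left kernel of the third power of the transfer matrix
   over 8 columns, each vector as a list of alternating identifiers and
   coefficients; it was found by elimination and LLL reduction, then made
   unitriangular modulo 2 with respect to the first identifier of each vector. *)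
Definition kernel_data : seq (seq Z) := ([::
   [:: 50; -1; 51; 1; 81; 1; 277; 1; 283; 1];
   [:: 195; -1; 197; 1; 266; 1];
   [:: 20; -1; 21; 1; 211; 1];
   [:: 82; -1; 49; 1];
   [:: 124; -1; 279; 1];
   [:: 137; -1; 252; 1];
   [:: 52; -1; 38; 1];
   [:: 207; -1; 93; 1];
   [:: 282; -1; 245; 1];
   [:: 11; -1; 13; 1; 32; 1];
   [:: 136; -1; 251; 1];
   [:: 120; -1; 166; 1];
   [:: 125; -1; 93; 1; 238; 1; 279; 1];
   [:: 221; -1; 94; 1];
   [:: 78; -1; 153; 1];
   [:: 77; -1; 156; 1; 215; 1; 259; -1];
   [:: 218; -1; 273; 1];
   [:: 219; -1; 200; 1];
   [:: 224; -1; 223; 1];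
   [:: 189; -1; 19; 1];
   [:: 186; -1; 272; 1];
   [:: 188; -1; 177; 1];
   [:: 284; -1; 97; 1];
   [:: 190; -1; 26; 1; 94; 1];
   [:: 44; -1; 287; 1];
   [:: 171; -1; 283; 1];
   [:: 164; -1; 151; 1];
   [:: 187; -1; 26; 1];
   [:: 204; -1; 37; 1];
   [:: 220; -1; 26; 1];
   [:: 294; -1; 14; -1; 26; -3; 42; 2; 94; 1; 172; -2; 174; -1; 175; 1; 183;
     1; 211; 1; 226; -1; 228; 3; 230; 1; 277; 1; 283; -3; 286; 1; 287; -2];
   [:: 155; -1; 289; 1];
   [:: 159; -1; 214; 1];
   [:: 142; -1; 8; 1; 79; 1];
   [:: 86; -1; 133; -1; 200; 1; 201; 1; 216; -1; 277; -1; 278; 1];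
   [:: 140; -1; 200; 1];
   [:: 147; -1; 181; 1; 185; 1];
   [:: 54; -1; 185; 1];
   [:: 17; -1; 79; 1];
   [:: 149; -1; 303; 1];
   [:: 281; -1; 184; 1];
   [:: 297; -1; 3; -1; 208; 2];
   [:: 235; -1; 200; 1];
   [:: 25; -1; 183; 1];
   [:: 213; -1; 67; 2];
   [:: 5; -1; 3; 1; 13; -2; 40; 1; 85; -1; 93; -1; 98; 2; 104; 1; 107; -2;
     133; 2; 153; 1; 174; 2; 175; -6; 176; 2; 201; 1; 208; 1; 209; 1; 215; 1;
     226; -1; 228; 1; 237; -1; 252; 1; 268; -1];
   [:: 61; -1; 175; 1; 216; 1];
   [:: 112; -1; 51; -1; 59; 1; 88; 1; 163; 1];
   [:: 254; -1; 13; 1; 51; 1; 163; -2; 279; 2];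
   [:: 89; -1; 63; 1; 176; -1; 278; -1];
   [:: 135; -1; 273; 1];
   [:: 270; -1; 79; 1];
   [:: 299; -1; 200; 1];
   [:: 56; -1; 93; 1];
   [:: 57; -1; 208; 1];
   [:: 271; -1; 67; 1; 94; -1];
   [:: 267; -1; 185; 1];
   [:: 117; -1; 98; -1; 104; 1];
   [:: 274; -1; 259; 1];
   [:: 233; -1; 200; 1; 201; 1];
   [:: 80; -1; 13; 1; 51; 1; 81; -1; 97; -1; 98; 1; 129; 1; 143; -3; 163; -2;
     184; 3; 272; 3; 279; 1];
   [:: 18; -1; 177; 1];
   [:: 24; -1; 26; 1; 94; 1];
   [:: 16; -1; 42; 1];
   [:: 305; -1; 200; 1];
   [:: 227; -1; 277; 1; 283; 1];
   [:: 306; -1; 133; 1; 273; 1];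
   [:: 145; -1; 277; 1];
   [:: 167; -1; 153; -1; 223; 1];
   [:: 134; -1; 37; -2; 101; 2; 151; 1; 185; -3; 192; -1; 201; -1; 226; 2;
     228; -3; 253; 3; 277; -1; 283; 1];
   [:: 255; -1; 151; 1];
   [:: 275; -1; 151; 1];
   [:: 203; -1; 261; 1];
   [:: 34; -1; 158; 1];
   [:: 178; -1; 19; 1; 79; 1];
   [:: 4; -1; 208; 1];
   [:: 290; -1; 37; 1];
   [:: 276; -1; 37; 1];
   [:: 231; -1; 172; 1];
   [:: 285; -1; 93; 1; 279; 1];
   [:: 194; -1; 209; 1];
   [:: 12; -1; 10; 1];
   [:: 232; -1; 37; 1; 152; 1; 201; -1; 226; 1; 228; -1];
   [:: 296; -1; 200; 1; 201; 1];
   [:: 71; -1; 13; 1; 38; 1; 51; 1; 66; 1; 75; -1; 76; 3; 81; -1; 98; 1; 129;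
     1; 163; -2; 279; 1];
   [:: 265; -1; 108; 3; 152; -5; 172; -6; 215; 6; 230; 3; 237; -3; 245; 1;
     259; -1];
   [:: 103; -1; 104; 2];
   [:: 139; -1; 45; 1; 226; 2; 228; -4; 277; -2; 283; 2; 286; 1; 287; -1];
   [:: 105; -1; 118; 1];
   [:: 249; -1; 153; -1; 223; 1];
   [:: 87; -1; 13; 1; 51; 1; 81; -1; 97; -1; 98; 1; 129; 1; 143; -3; 163; -2;
     184; 3; 272; 3; 279; 1];
   [:: 154; -1; 37; 1; 67; -2; 79; -1; 107; 1; 126; -1; 133; -1; 150; -1; 151;
     -1; 165; 1; 172; 1; 181; 1; 209; 1; 288; 1; 289; -1; 298; -1; 300; 1];
   [:: 30; -1; 3; 4; 31; 2; 37; 2; 95; -2; 151; -1; 153; 2; 185; 5; 201; 1;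
     208; -8; 226; -1; 228; 1; 248; -2; 253; -1; 262; 1];
   [:: 115; -1; 13; -1; 102; 1; 104; -2; 107; 1; 114; -1; 126; -1; 133; -1;
     165; 1; 172; 1; 215; 1; 259; -1; 288; -1; 289; 3];
   [:: 169; -1; 201; 1];
   [:: 100; -1; 129; 1; 131; -1];
   [:: 53; -1; 185; 1; 298; 1];
   [:: 123; -1; 81; 1; 129; -1; 131; 1; 163; 1; 283; 1];
   [:: 119; -1; 85; 1; 166; 1; 208; 1];
   [:: 116; -1; 81; -1; 122; 1; 129; 1];
   [:: 234; -1; 19; 1; 201; -1; 209; 1; 226; 1; 228; -1; 288; 2; 289; -2; 300;
     -1];
   [:: 198; -1; 302; 1; 303; -1];
   [:: 229; -1; 283; 1];
   [:: 241; -1; 185; -1; 206; 1];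
   [:: 58; -1; 13; -1; 59; 1; 85; 1; 98; 1; 191; 1; 208; 1];
   [:: 110; -1; 152; 1; 215; 1; 245; -1; 259; -2; 288; -3; 289; 7];
   [:: 127; -1; 215; -1; 259; 1; 273; 1];
   [:: 258; -1; 107; 1; 108; 1; 126; -2; 133; -1; 165; 2; 172; 2; 280; -1];
   [:: 121; -1; 38; 1; 39; -1; 268; -1];
   [:: 83; -1; 2; 1; 3; 3; 26; -2; 67; 1; 85; -2; 93; -3; 95; 1; 107; -9; 133;
     8; 138; 1; 153; 1; 174; 6; 175; -23; 176; 9; 208; -2; 211; 1; 216; -1;
     278; 1];
   [:: 72; -1; 38; 1; 66; 1; 98; 1];
   [:: 180; -1; 3; -1; 208; 2];
   [:: 217; -1; 81; 1; 129; -1; 131; 1; 184; 1];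
   [:: 307; -1; 3; 1; 13; -2; 85; -1; 93; -1; 98; 2; 107; -2; 133; 2; 153; 1;
     174; 2; 175; -6; 176; 2; 201; 1; 209; 1; 215; 1; 226; -1; 228; 1; 237;
     -1; 268; -1];
   [:: 132; -1; 3; -2; 13; -1; 28; 1; 39; -1; 40; 1; 85; 2; 93; 2; 98; 1; 101;
     -1; 102; 1; 104; -3; 107; 2; 114; -1; 131; -1; 133; -2; 153; -1; 174; -3;
     175; 6; 176; -2; 211; -1; 228; 1; 283; -2];
   [:: 111; -1; 152; 1; 245; -1; 259; -1; 288; -2; 289; 4];
   [:: 130; -1; 131; 1; 184; 1];
   [:: 141; -1; 215; 1; 259; -1; 288; -1; 289; 2];
   [:: 269; -1; 37; 1; 152; 1; 201; -1; 226; 1; 228; -1];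
   [:: 168; -1; 108; 4; 118; 2; 152; -5; 166; -2; 172; -8; 191; 1; 215; 6;
     230; 4; 237; -4; 245; 1; 259; -1];
   [:: 109; -1; 67; -1; 300; 1];
   [:: 84; -1; 107; -1; 175; -1; 176; 1; 216; -1; 278; 1];
   [:: 36; -1; 150; -1; 303; 1];
   [:: 257; -1; 133; -1; 201; 1; 216; -1; 277; -1; 278; 1];
   [:: 55; -1; 47; 1];
   [:: 205; -1; 277; 1];
   [:: 173; -1; 19; 1; 79; 1];
   [:: 68; -1; 13; -1; 66; 1; 85; -1; 98; 1; 107; -3; 108; 2; 126; -3; 133; 3;
     138; 1; 165; 4; 166; -1; 172; 3; 175; -3; 176; 3; 209; -1; 273; 1; 288;
     -1; 289; 1];
   [:: 113; -1; 51; -1; 59; 1; 114; 1; 163; 1];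
   [:: 35; -1; 209; 1; 243; 1; 288; 1; 289; -1; 298; -1];
   [:: 295; -1; 201; 1; 277; -1];
   [:: 6; -1; 2; 2; 3; -1; 26; -3; 93; -1; 94; 1; 108; -1; 126; 3; 153; 1;
     165; -4; 166; 1; 172; -3; 174; 2; 175; -7; 183; 1; 211; 1; 273; -1; 288;
     1; 289; -1];
   [:: 160; -1; 215; 1];
   [:: 210; -1; 85; 1; 166; 1; 208; 1];
   [:: 69; -1; 70; 1; 185; 1; 222; 1; 253; -1; 262; 1; 300; 1];
   [:: 23; -1; 67; 1; 94; -1];
   [:: 46; -1; 37; -1; 45; -1; 47; 1; 66; 1; 185; 1; 253; -1];
   [:: 247; -1; 108; 4; 118; 1; 152; -5; 166; -1; 172; -8; 215; 6; 230; 4;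
     237; -4; 245; 1; 259; -1];
   [:: 179; -1; 152; 1; 288; 1];
   [:: 161; -1; 43; 1; 45; 1; 98; 1; 99; -1; 104; -1; 206; -1; 242; 1; 287;
     -1; 291; 1];
   [:: 146; -1; 98; -1; 104; 1];
   [:: 170; -1; 277; 1; 283; 1];
   [:: 144; -1; 45; -1; 287; 1];
   [:: 246; -1; 152; 1; 215; -1];
   [:: 7; -1; 2; 1; 3; -1; 175; -1];
   [:: 9; -1; 1; 1; 32; -1; 42; -1; 45; 1; 99; -1; 122; -1; 126; -1; 165; 1;
     172; 1; 174; -1; 175; 1; 206; -1; 242; 1; 291; 1];
   [:: 126; 5; 85; 2; 90; -1; 91; 1; 107; 5; 133; -5; 165; -7; 166; 2; 172;
     -6; 175; 5; 176; -5; 273; -2; 288; 2; 289; -2];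
   [:: 208; 1; 21; 1; 26; 1; 51; -1; 75; 1; 76; -2; 81; 1; 93; -1; 129; -1;
     153; -1; 163; 2; 174; 1; 175; -1; 211; -1; 223; 1; 279; -1];
   [:: 223; -1; 3; 1; 13; 3; 37; 2; 85; -1; 93; -1; 98; -3; 101; -1; 107; -1;
     133; 1; 151; -1; 153; 1; 174; 1; 175; -3; 176; 1; 185; 2; 192; 1; 201; 1;
     226; -2; 228; 3; 253; -2; 268; 3; 277; 1; 283; -1];
   [:: 39; -3; 3; -1; 13; -1; 40; 3; 60; 2; 62; -2; 85; 1; 88; 2; 90; 2; 93;
     1; 98; 1; 101; -3; 102; 1; 104; -3; 106; 3; 107; 1; 114; -1; 133; -3;
     174; -1; 175; 3; 176; -1; 209; 2; 215; 2; 216; -2; 223; -2; 259; -2; 273;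
     -2; 278; 2; 288; 2; 289; -2];
   [:: 209; 1; 3; -3; 13; -1; 19; -2; 37; -4; 45; -2; 47; 2; 51; -4; 59; 1;
     79; 1; 81; -2; 85; 1; 90; 2; 91; -1; 93; 3; 97; -2; 98; 5; 101; 1; 102;
     2; 104; -4; 107; -4; 108; -2; 114; -2; 118; 2; 126; -2; 129; 2; 133; 3;
     143; -4; 151; 1; 153; -3; 163; 2; 165; 6; 166; -6; 172; 3; 174; -3; 175;
     4; 176; 2; 182; -1; 184; 4; 191; -2; 192; -1; 201; -1; 215; -2; 216; -1;
     223; 2; 225; -2; 228; 1; 259; 2; 260; -2; 268; -3; 272; 4; 273; 1; 277;
     1; 278; 1; 279; 2; 280; 2; 283; -1; 288; -2; 289; -1; 300; 2];
   [:: 2; -1; 3; 1; 8; 1; 13; 1; 19; 1; 21; -2; 22; 2; 37; 3; 38; -1; 39; 2;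
     40; -1; 45; 1; 47; -1; 51; 3; 59; -2; 67; -1; 74; -1; 75; 3; 76; -3; 79;
     -2; 81; 4; 85; -1; 90; -3; 93; 1; 95; -1; 97; 2; 98; -6; 102; -1; 104; 4;
     107; 3; 108; 2; 114; 1; 118; -1; 122; -1; 126; -4; 129; -4; 131; 1; 138;
     1; 143; 4; 148; -1; 150; -1; 151; -1; 153; 5; 156; 1; 165; 2; 166; 3;
     172; 5; 174; -2; 175; 4; 176; 1; 182; 2; 184; -4; 185; 1; 191; 1; 192; 1;
     199; -1; 200; 1; 201; 1; 202; 1; 209; -6; 211; 1; 212; -1; 216; 3; 222;
     -1; 223; -2; 225; 2; 226; 1; 228; -2; 236; 1; 237; 1; 238; 1; 239; -1;
     243; -2; 253; -1; 259; -1; 260; 2; 268; 3; 272; -4; 273; 2; 277; -2; 278;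
     -3; 279; -3; 280; -4; 283; 1; 288; -3; 289; 6; 293; -1; 298; 2; 300; -2;
     303; 1];
   [:: 118; -3; 2; -2; 3; -2; 8; -1; 13; 1; 19; 3; 21; 4; 22; -2; 26; 8; 37;
     7; 38; 1; 39; 4; 40; -5; 45; 3; 47; -3; 51; 3; 60; -4; 62; 4; 67; -2; 74;
     1; 75; -2; 76; 1; 81; 1; 85; -1; 88; -4; 90; -5; 91; 2; 93; -3; 95; -3;
     97; 2; 98; -6; 101; 3; 102; -5; 104; 10; 106; -6; 107; 7; 108; 3; 114; 5;
     122; 1; 126; -6; 129; -1; 131; -1; 133; -4; 138; -1; 143; 4; 148; 1; 150;
     1; 151; -2; 156; -1; 165; 6; 166; 3; 172; 5; 174; -5; 175; 25; 176; -8;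
     184; -4; 185; 1; 191; 3; 192; 2; 199; 1; 200; -1; 201; 3; 202; -1; 208;
     10; 211; -6; 212; 1; 216; 3; 222; 1; 223; 2; 225; 2; 226; -3; 228; 3;
     236; -1; 237; -1; 238; -1; 239; 1; 243; 2; 253; -1; 259; 1; 260; 2; 268;
     5; 272; -4; 273; 6; 278; -3; 279; -3; 280; 1; 288; -3; 289; 6; 293; 1;
     298; -2; 300; -2; 303; -1];
   [:: 1; -147; 2; 170; 3; 1513; 8; 485; 10; 187; 13; 4355; 14; 475; 15; -63;
     19; -864; 21; 2221; 22; -1122; 26; 3152; 27; -1004; 28; 440; 29; -659;
     31; 1201; 32; 173; 33; 237; 37; 940; 38; 330; 39; -760; 40; 428; 41; -95;
     42; -840; 43; 3; 45; -667; 47; -8; 48; 770; 49; 491; 51; 389; 59; 156;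
     60; 62; 62; 731; 63; 21; 64; 299; 65; 362; 66; -506; 67; -1474; 70; -180;
     73; 34; 74; -107; 75; -506; 76; 720; 79; -808; 81; -1494; 85; 1258; 88;
     -738; 90; 224; 91; -269; 93; -1125; 94; -1081; 95; -908; 96; 90; 97;
     -597; 98; 50; 99; 730; 101; -873; 102; -112; 104; -1750; 106; -1215; 107;
     2519; 108; -99; 114; 642; 118; -96; 122; 783; 126; -1444; 128; 32; 129;
     1663; 131; -1484; 133; -3189; 138; 565; 143; -1242; 148; -467; 150;
     -1320; 151; -213; 152; 535; 153; -1982; 156; -1199; 157; 287; 158; -201;
     162; 107; 163; -2034; 165; 1065; 166; 395; 172; 2647; 174; 1369; 175;
     -1083; 176; -699; 177; -318; 181; 550; 182; -72; 183; -413; 184; 1151;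
     185; 3438; 191; 344; 192; 453; 193; 340; 196; -563; 197; 445; 199; 784;
     200; -162; 201; -2176; 202; 542; 206; 388; 208; -3174; 209; -2492; 211;
     -2787; 212; -484; 214; -955; 215; -1248; 216; -1287; 222; -957; 223;
     1084; 225; 266; 226; 3634; 228; -4342; 230; -445; 236; 336; 237; 33; 238;
     445; 239; -796; 240; 93; 242; -582; 243; -517; 244; 288; 245; -380; 248;
     -1580; 250; -282; 251; 8; 253; -769; 259; 1440; 260; 302; 261; 163; 262;
     664; 263; -128; 264; -85; 266; -230; 268; 1312; 272; 1444; 273; -1353;
     277; -1484; 278; 818; 279; 2061; 280; -784; 283; 1286; 286; -512; 287;
     1017; 288; -367; 289; 423; 291; -377; 292; 94; 293; -245; 298; -236; 300;
     375; 301; -64; 302; -593; 303; 1089; 304; 622];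
   [:: 74; -191; 1; 182; 2; 504; 3; -1806; 8; -83; 10; -280; 13; 401; 14;
     -319; 15; -7; 19; 369; 21; 136; 22; 852; 26; -2838; 27; -435; 28; -82;
     29; 322; 31; -581; 32; -153; 33; 380; 37; -1442; 38; -758; 39; 820; 40;
     -38; 41; -101; 42; 507; 43; -454; 45; -1256; 47; -85; 48; 427; 49; 423;
     51; -813; 59; -159; 60; -1285; 62; 1572; 63; -156; 64; 355; 65; 102; 66;
     -241; 67; -552; 70; -194; 73; 37; 75; 1092; 76; -1415; 79; -318; 81;
     -1156; 85; 1703; 88; -1430; 90; 312; 91; -859; 93; 642; 94; 543; 95;
     1665; 96; 12; 97; 713; 98; 456; 99; 1146; 101; -1559; 102; -897; 104;
     -392; 106; -2725; 107; 2527; 108; 179; 114; 1302; 118; -286; 122; 1359;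
     126; -2400; 128; 4; 129; 1189; 131; -1485; 133; -1725; 138; -24; 143;
     864; 148; 260; 150; -340; 151; 617; 152; 1074; 153; -1717; 156; -284;
     157; 118; 158; -389; 162; 845; 163; 470; 165; 480; 166; 1677; 172; 2889;
     174; -1043; 175; -1412; 176; 904; 177; -381; 181; 569; 182; -340; 183;
     828; 184; -1447; 185; -1590; 191; 600; 192; -291; 193; -168; 196; -454;
     197; -266; 199; -157; 200; -958; 201; -116; 202; -257; 206; 544; 208;
     1016; 209; -550; 211; 802; 212; -451; 214; 452; 215; -2884; 216; 803;
     222; 42; 223; -1690; 225; -619; 226; -578; 228; 1022; 230; 97; 236; -391;
     237; -936; 238; 528; 239; -1529; 240; -416; 242; -918; 243; 1016; 244;
     219; 245; -523; 248; 863; 250; 201; 251; -54; 253; 434; 256; -139; 259;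
     1949; 260; -530; 261; 161; 262; 597; 263; -325; 264; 15; 266; -101; 268;
     1891; 272; -612; 273; -1464; 277; 71; 278; -628; 279; 578; 280; -2412;
     283; -949; 286; 300; 287; -174; 288; 3267; 289; -3979; 291; -615; 292;
     207; 293; -1066; 298; -1614; 300; -160; 301; -35; 302; -537; 303; 314;
     304; 1030];
   [:: 41; 89; 1; -168; 2; -160; 3; -2421; 8; 466; 10; 4; 13; -1487; 14;
     -1338; 15; -117; 19; 235; 21; -421; 22; 1114; 26; -3901; 27; 422; 28;
     -673; 29; 818; 31; -1589; 32; 141; 33; -115; 37; -3308; 38; -488; 39;
     774; 40; -320; 42; 3244; 43; 364; 45; 766; 47; 963; 48; -424; 49; 72; 51;
     2168; 59; -1762; 60; -608; 62; 99; 63; 332; 64; -670; 65; 342; 66; 1090;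
     67; -237; 70; -940; 73; 59; 74; 28; 75; 388; 76; -860; 79; 290; 81; 1559;
     85; -236; 88; -345; 90; 565; 91; -108; 93; 340; 94; 257; 95; 1860; 96;
     -265; 97; 1112; 98; -404; 99; -919; 101; -604; 102; -728; 104; 2810; 106;
     -67; 107; -387; 108; 632; 114; 2246; 118; 936; 122; -308; 126; -688; 128;
     27; 129; -2018; 131; 1581; 133; -1987; 138; -262; 143; 940; 148; -552;
     150; -862; 151; 1148; 152; -803; 153; -645; 156; 756; 157; -465; 158;
     -13; 162; 581; 163; -2046; 165; 2202; 166; -2239; 172; -2656; 174; 831;
     175; -819; 176; -88; 177; 136; 181; -308; 182; -253; 183; 1354; 184;
     -1216; 185; -3775; 191; -1016; 192; -1118; 193; -342; 196; -66; 197;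
     -148; 199; -638; 200; 846; 201; 1173; 202; 571; 206; -290; 208; 4988;
     209; -144; 211; 1841; 212; 56; 214; 829; 215; -630; 216; -1263; 222; 88;
     223; 174; 225; 313; 226; -2645; 228; 4762; 230; 1545; 236; 1118; 237;
     159; 238; -174; 239; -315; 240; -577; 242; 270; 243; -2823; 244; -24;
     245; 486; 248; 2171; 250; 561; 251; 63; 253; 33; 256; -159; 259; 21; 260;
     227; 261; 73; 262; 461; 263; 248; 264; 156; 266; -80; 268; -1708; 272;
     -1794; 273; 715; 277; 1643; 278; 1592; 279; 368; 280; -54; 283; -3673;
     286; 1062; 287; -3916; 288; 499; 289; -2318; 291; 582; 292; 354; 293;
     238; 298; 3290; 300; -759; 301; 522; 302; -103; 303; 467; 304; 626];
   [:: 43; 289; 1; 104; 2; -422; 3; 1216; 8; -567; 10; -955; 13; -2011; 14;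
     -742; 15; 135; 19; -215; 21; 643; 22; -246; 26; 52; 27; -1091; 28; 401;
     29; -244; 31; 505; 32; -93; 33; -460; 37; 2086; 38; 409; 39; -1906; 40;
     1504; 41; 108; 42; 1163; 45; 2527; 47; -585; 48; 584; 49; 329; 51; -135;
     59; 672; 60; 2760; 62; -1448; 63; -96; 64; -793; 65; 2400; 66; 1496; 67;
     -9013; 70; 372; 73; -60; 74; 162; 75; -614; 76; 1066; 79; 661; 81; -583;
     85; -1006; 88; 1508; 90; -1028; 91; 478; 93; -1076; 94; 811; 95; -1199;
     96; -225; 97; -114; 98; 1657; 99; -1613; 101; 1134; 102; 497; 104; -2065;
     106; 2629; 107; -2949; 108; -1731; 114; -1809; 118; -220; 122; 125; 126;
     2918; 128; -36; 129; 429; 131; -43; 133; 3906; 138; -51; 143; 85; 148;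
     367; 150; -852; 151; -477; 152; -1031; 153; 2663; 156; 705; 157; -428;
     158; 496; 162; -71; 163; 1353; 165; -2161; 166; -506; 172; -4663; 174;
     -602; 175; 1270; 176; 10; 177; 357; 181; -972; 182; 155; 183; 689; 184;
     -115; 185; 127; 191; 92; 192; 600; 193; -148; 196; 386; 197; 118; 199;
     -158; 200; -804; 201; 181; 202; -584; 206; -699; 208; -234; 209; 488;
     211; -1411; 212; 691; 214; -388; 215; 3429; 216; 1134; 222; 408; 223;
     366; 225; 285; 226; -34; 228; 1236; 230; 902; 236; -168; 237; -402; 238;
     -609; 239; 1634; 240; -426; 242; 1096; 243; 175; 244; -33; 245; 477; 248;
     -1004; 250; -444; 251; 13; 253; 769; 256; 48; 259; -1831; 260; 163; 261;
     -373; 262; -1691; 263; -12; 264; 294; 266; 585; 268; -1376; 272; -282;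
     273; 3418; 277; -891; 278; -1434; 279; -2140; 280; 2137; 283; -1201; 286;
     1178; 287; -2740; 288; -4651; 289; 6056; 291; 880; 292; -568; 293; 783;
     298; 575; 300; 696; 301; 326; 302; -1170; 303; 617; 304; -1093];
   [:: 138; -485; 1; -864; 2; 120; 3; 3392; 8; -149; 10; 1046; 13; 1960; 14;
     1476; 15; 85; 19; -160; 21; 199; 22; 221; 26; 5851; 27; 639; 28; 1238;
     29; -1290; 31; 2297; 32; 824; 33; -91; 37; 1024; 38; 113; 39; 114; 40;
     -212; 41; 86; 42; -2258; 43; 1200; 45; 1096; 47; -553; 48; -344; 49;
     -1434; 51; -882; 59; -193; 60; 295; 62; -868; 63; -424; 64; -668; 65;
     238; 66; 902; 67; 1144; 70; 299; 73; 69; 74; 326; 75; 49; 76; -309; 79;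
     -43; 81; 1822; 85; 1693; 88; 1174; 90; 770; 91; 198; 93; 2213; 94; -4361;
     95; -2476; 96; 622; 97; -1417; 98; 1098; 99; -1166; 101; 3521; 102; -380;
     104; 1928; 106; 1817; 107; 368; 108; -1228; 114; 502; 118; -176; 122;
     -1180; 126; 1660; 128; -17; 129; -1562; 131; 590; 133; 1521; 143; -1826;
     148; 2216; 150; 1330; 151; -1025; 152; -32; 153; 3811; 156; 839; 157;
     -189; 158; 83; 162; -760; 163; 1638; 165; -133; 166; -45; 172; 1143; 174;
     1543; 175; 908; 176; -1826; 177; -235; 181; -179; 182; -293; 183; -2192;
     184; 3023; 185; 4198; 191; -296; 192; 824; 193; 489; 196; 210; 197; -217;
     199; -346; 200; 262; 201; -1603; 202; -2413; 206; -594; 208; -10674; 209;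
     3644; 211; -2906; 212; 908; 214; 418; 215; 3687; 216; 477; 222; -68; 223;
     -1204; 225; -979; 226; 457; 228; -1653; 230; -1455; 236; -1307; 237;
     -894; 238; -743; 239; 1565; 240; 707; 242; 653; 243; 2555; 244; -334;
     245; -236; 248; -3136; 250; -865; 251; -67; 253; 721; 256; 74; 259;
     -3944; 260; -1186; 261; 16; 262; -1005; 263; -682; 264; -136; 266; 193;
     268; -1127; 272; 1409; 273; 649; 277; 230; 278; -1303; 279; -83; 280;
     2310; 283; 2081; 286; -1112; 287; 2271; 288; -1641; 289; 4186; 291; 739;
     292; -638; 293; 1208; 298; -2041; 300; 325; 301; 488; 302; -375; 303;
     -1823; 304; -725];
   [:: 10; 623; 1; 502; 2; -644; 3; -3482; 8; 1487; 13; 2378; 14; -320; 15;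
     -158; 19; -2699; 21; 1536; 22; -1548; 26; -560; 27; -977; 28; -195; 29;
     842; 31; -1598; 32; -540; 33; 280; 37; 1563; 38; 525; 39; -1810; 40;
     1230; 41; -134; 42; 321; 43; -742; 45; 1646; 47; -644; 48; 648; 49; 477;
     51; 1783; 59; -651; 60; 971; 62; -182; 63; 476; 64; 41; 65; 813; 66; 313;
     67; -5832; 70; -369; 73; -25; 74; -846; 75; -93; 76; 924; 79; -553; 81;
     -1459; 85; -362; 88; -156; 90; 1168; 91; -847; 93; -1749; 94; 2424; 95;
     1564; 96; -599; 97; -307; 98; -1856; 99; 547; 101; -4204; 102; -23; 104;
     723; 106; -167; 107; -864; 108; -1956; 114; 911; 118; -998; 122; -612;
     126; 32; 128; 48; 129; 1329; 131; 143; 133; -1719; 138; 1910; 143; -1249;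
     148; -2129; 150; -2492; 151; 365; 152; 440; 153; -5704; 156; -1703; 157;
     -94; 158; -144; 162; -361; 163; -5601; 165; -2099; 166; 2617; 172; 976;
     174; 212; 175; -849; 176; 1554; 177; -86; 181; 427; 182; 829; 183; 937;
     184; 1297; 185; -4449; 191; 1243; 192; -1302; 193; 211; 196; -340; 197;
     1080; 199; 1069; 200; 958; 201; -1992; 202; 2484; 206; 576; 208; 9602;
     209; -7226; 211; -286; 212; -1873; 214; -1394; 215; -1907; 216; -2391;
     222; -2151; 223; 2014; 225; 409; 226; 1564; 228; 1006; 230; 239; 236;
     1034; 237; 2169; 238; 1410; 239; -1836; 240; 473; 242; -540; 243; -1875;
     244; 392; 245; -125; 248; 2152; 250; 9; 251; 68; 253; 765; 256; -70; 259;
     1427; 260; 581; 261; 225; 262; 1658; 263; 700; 264; -33; 266; -626; 268;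
     -1226; 272; 2076; 273; -2252; 277; 1133; 278; 2156; 279; 3678; 280;
     -1628; 283; -2405; 286; -781; 287; 69; 288; -2130; 289; 2052; 291; -486;
     292; 515; 293; -1199; 298; 944; 300; 1331; 301; 71; 302; -636; 303; 2805;
     304; 441];
   [:: 156; 3195; 1; -608; 2; 688; 3; 664; 8; -920; 10; -912; 13; -5197; 14;
     691; 15; 198; 19; 1847; 21; -862; 22; 2776; 26; 3658; 27; -397; 28; 1882;
     29; -430; 31; 627; 32; 471; 33; -345; 37; 468; 38; -850; 39; 986; 40;
     -138; 41; 286; 42; -1090; 43; 1458; 45; 2681; 47; 277; 48; 230; 49;
     -1106; 51; 2649; 59; -1995; 60; -1409; 62; 1799; 63; -259; 64; -1400; 65;
     2248; 66; 1962; 67; -2790; 70; -343; 73; 134; 74; 912; 75; -177; 76;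
     -278; 79; 314; 81; 3009; 85; 2021; 88; -1614; 90; -2899; 91; 1258; 93;
     2985; 94; -6767; 95; 378; 96; 673; 97; 60; 98; 3001; 99; -3161; 101;
     4523; 102; 2898; 104; -7103; 106; -1798; 107; 1278; 108; 206; 114; -2959;
     118; 792; 122; -1050; 126; 1028; 128; -59; 129; -3526; 131; 955; 133;
     2061; 138; -1920; 143; 404; 148; 2775; 150; -86; 151; -1281; 152; -2231;
     153; 5268; 157; -559; 158; 331; 162; 433; 163; 653; 165; 2101; 166;
     -2586; 172; -1852; 174; 1560; 175; -1465; 176; -3029; 177; -113; 181;
     -986; 182; -776; 183; -1547; 184; 174; 185; 1524; 191; -1851; 192; 1226;
     193; -644; 196; 1033; 197; -985; 199; -1986; 200; -893; 201; 1471; 202;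
     -3262; 206; -1528; 208; -7200; 209; 4802; 211; -3127; 212; 2419; 214;
     1566; 215; 3587; 216; 1947; 222; 1706; 223; -2264; 225; -297; 226; -3037;
     228; 3095; 230; -177; 236; -468; 237; -2585; 238; -1968; 239; 2667; 240;
     -722; 242; 1567; 243; 439; 244; -309; 245; 1059; 248; -1190; 250; -1350;
     251; -22; 253; -505; 256; -160; 259; -2165; 260; -726; 261; -356; 262;
     -2361; 263; -1085; 264; 129; 266; 903; 268; 51; 272; -2265; 273; 3965;
     277; -1733; 278; -3630; 279; -3221; 280; 2546; 283; 537; 286; -2; 287;
     -496; 288; -243; 289; -47; 291; 1965; 292; -830; 293; 2126; 298; 1045;
     300; -1029; 301; 1028; 302; -1631; 303; -1461; 304; -186];
   [:: 64; -1617; 1; -660; 2; -744; 3; 2996; 8; -338; 10; -1098; 13; 2004; 14;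
     1505; 15; -10; 19; 403; 21; -134; 22; 212; 26; 8702; 27; -735; 28; -82;
     29; -739; 31; 1275; 32; 652; 33; -464; 37; 3087; 38; 148; 39; -392; 40;
     230; 41; 92; 42; -2208; 43; 920; 45; -631; 47; 91; 48; 548; 49; 36; 51;
     -285; 59; 698; 60; 788; 62; -2; 63; -78; 65; 3564; 66; 2344; 67; -12930;
     70; 43; 73; 29; 74; 588; 75; -1629; 76; 2169; 79; 290; 81; -1057; 85;
     -1582; 88; 36; 90; -1598; 91; 1412; 93; -527; 94; -3781; 95; -3344; 96;
     518; 97; -1553; 98; 2578; 99; -533; 101; 1317; 102; 1213; 104; -4237;
     106; 457; 107; -1849; 108; 653; 114; -2467; 118; 248; 122; 925; 126;
     2748; 128; -19; 129; 835; 131; 445; 133; 2713; 138; -1006; 143; -2384;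
     148; 627; 150; -3620; 151; -1828; 152; -1222; 153; 7376; 156; 804; 157;
     428; 158; 382; 162; 8; 163; 1737; 165; -79; 166; -1964; 172; -2446; 174;
     2702; 175; 402; 176; -1805; 177; 394; 181; -314; 182; -309; 183; -2547;
     184; 2234; 185; 4231; 191; -791; 192; 1329; 193; -352; 196; 685; 197;
     -376; 199; -348; 200; 52; 201; 908; 202; -850; 206; -524; 208; -2608;
     209; 2320; 211; -3056; 212; 1226; 214; -254; 215; 2690; 216; 716; 222;
     776; 223; -1528; 225; 299; 226; 2959; 228; -7739; 230; -994; 236; 414;
     237; -571; 238; -948; 239; 1973; 240; -409; 242; 852; 243; -1091; 244;
     -176; 245; 368; 248; -1663; 250; -101; 251; 2; 253; -1374; 256; 131; 259;
     -1182; 260; 190; 261; -379; 262; -1346; 263; 17; 264; -182; 266; 590;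
     268; 1068; 272; 1326; 273; 1739; 277; -4279; 278; -544; 279; -1186; 280;
     3742; 283; 6526; 286; -824; 287; 2205; 288; -2303; 289; 2410; 291; 582;
     292; -359; 293; 1737; 298; 1245; 300; -195; 301; 1110; 302; -2545; 303;
     1918; 304; -540]])%BZ.
(* nil_data / nil_denom is the nilpotent component of the vector of numbers of
   completions with 8 columns left; the transfer over 8 columns kills it. *)
Definition nil_denom : Z := 12209692851887155746096988%BZ.
Definition nil_data : seq Z := [::
  30; -111136605777126140211176; 31; -492944777008862439863433; 33;
  464725252328232772260014; 34; 492944777008862439863433; 35;
  -353588646551106632048838; 73; -1700638409975125415305085; 74;
  1700638409975125415305085; 157; -492944777008862439863433; 158;
  492944777008862439863433; 197; 37585713764739846039548; 198;
  -37585713764739846039548; 239; 464725252328232772260014; 240;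
  590361392997407272812569; 243; -353588646551106632048838; 244;
  339959858131754536808709; 248; -437376474120299369757845; 263;
  84896798079965179838438; 264; -47311084315225333798890; 266;
  -37585713764739846039548; 292; 1458186369201144923467423; 293;
  -1458186369201144923467423; 301; 368854049604753498837035; 302;
  -37585713764739846039548; 304; -331268335840013652797487]%BZ.

Definition kernel : seq lincomb := Eval vm_compute in map entries kernel_data.

Definition nil_part : tree Z := Eval vm_compute in tree_of (entries nil_data).

(** For the row vector k of [r], the first test is k (T e_0 - n) = 0 multiplied by [nil_denom]. The
    second one, on k T, yields k T^j e_0 = 0 for all j >= 2. Together they make k orthogonal to all
    T^j v. *)
Definition kernel_row_ok (r : lincomb) : bool :=
  let t := push_block (tree_of r) in
  Z.eqb (Z.mul nil_denom (empty_weight 0 t)) (rdot (zget nil_part) r) && kill 24 0 t.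

Definition in_range (i : positive) : bool := Pos.leb i 307.

Definition coef (r : lincomb) (i : positive) : Z :=
  foldr (fun e x => if Pos.eqb e.1 i then Z.add e.2 x else x) Z0 r.

Definition lead (i : nat) : positive := (head (xH, Z0) (nth [::] kernel i)).1.

Definition unitriangular_mod2 : bool :=
  all (fun i => let r := nth [::] kernel i in
                Z.odd (coef r (lead i)) &&
                all (fun j => ~~ Z.odd (coef r (lead j))) (iota 0 i))
      (iota 0 161).

Lemma kernel_okT : all kernel_row_ok kernel = true.
Proof. vm_cast_no_check (erefl true). Qed.

Lemma kernel_in_range :
  (size kernel == 161) && all (all (fun e => in_range e.1)) kernel = true.
Proof. vm_cast_no_check (erefl true). Qed.

Lemma kernel_unitriangular : unitriangular_mod2 = true.
Proof. vm_cast_no_check (erefl true). Qed.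

Lemma ids_in_range : tkeys in_range (tabl 0) && tkeys in_range nil_part = true.
Proof. vm_cast_no_check (erefl true). Qed.

Lemma nil_part_okT : tall (Z.eqb Z0) (pull_block nil_part) && Z.eqb Z0 (zget nil_part 1) = true.
Proof. vm_cast_no_check (erefl true). Qed.

Local Opaque kernel nil_part nil_denom.

(** * The stable part of the counts and its rank *)

(* nil_denom times T^j v for v = T e_0 - n. *)
Definition stable (j : nat) (i : positive) : Z :=
  (nil_denom * zcompl 0 (8 * j.+1) i - (if j is 0 then zget nil_part i else 0))%R.

Lemma stable_step j i : transfer_block (stable j) i = stable j.+1 i.
Proof.
(* [stable j] is written as a combination of two functions so that linearity of the block applies;
   the nilpotent part occurs at j = 0 only and is sent to 0. *)
pose c (k : 'I_2) : Z := if k == 0 then nil_denom else -1.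
pose F (k : 'I_2) : positive -> Z := if k == 0 then zcompl 0 (8 * j.+1) else
  if j is 0 then zget nil_part else fun=> 0.
have e : stable j =1 fun i => \sum_k c k * F k i.
  by move=> k; rewrite big_ord_recl big_ord1 /c /F /stable /=; case: j {F}; rewrite mulN1r.
rewrite (eq_pullf_block e) transfer_block_lincomb big_ord_recl big_ord1 /c /F /=.
have -> : transfer_block (zcompl 0 (8 * j.+1)) i = zcompl 0 (8 * j.+2) i.
  by rewrite [LHS]transfer_block_compl -mulnS.
case: j {c F e} => [|j].
  rewrite -zget_pull_block /stable.
  have /andP[n0 _] := nil_part_okT; rewrite /zget.
  case e: tget => [z|] /=; last by rewrite mulr0.
  by have /Z.eqb_eq <- := tallP n0 e; rewrite mulr0.
suff -> : transfer_block (fun=> 0 : Z) i = 0 by rewrite mulr0.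
have e0 : (fun=> 0 : Z) =1 fun _ : positive => \sum_(k < 0) (0 : Z) * 0.
  by move=> ?; rewrite big_ord0.
by rewrite (eq_pullf_block e0) transfer_block_lincomb big_ord0.
Qed.

Lemma stable_empty j : stable j 1 = nil_denom * (num_L_tilings 9 (8 * j.+1))%:R.
Proof.
rewrite /stable num_L_tilingsE -compl_empty /zcompl.
have /andP[_ /Z.eqb_eq n1] := nil_part_okT.
by case: j => [|j]; rewrite -?n1 subr0.
Qed.

Lemma rdotE f r : rdot f r = \sum_(e <- r) e.2 * f e.1.
Proof. by elim: r => [|e r IHr]; rewrite ?big_nil ?big_cons //= IHr. Qed.

Lemma rdot_stable r j : kernel_row_ok r -> rdot (stable j) r = 0.
Proof.
case/andP=> /Z.eqb_eq w kt.
have -> : rdot (stable j) r = nil_denom * rdot (zcompl 0 (8 * j.+1)) r -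
    (if j is 0 then rdot (zget nil_part) r else 0).
  rewrite !rdotE mulr_sumr; case: j => [|j]; rewrite ?subr0 -?sumrB.
    by apply: eq_bigr => e _; rewrite /stable mulrBr mulrCA.
  by apply: eq_bigr => e _; rewrite /stable subr0 mulrCA.
rewrite -dot_tree_of mulnS -dot_push_block.
(* The first test in [kernel_row_ok] settles j = 0, the killing settles all later j. *)
case: j => [|j]; first by rewrite -w muln0 empty_weightE subrr.
by rewrite mulnS (kill_compl _ kt) mulr0 subr0.
Qed.

Definition id_of (s : 'I_307) : positive := Pos.of_succ_nat s.

Lemma id_of_inj : injective id_of.
Proof. by move=> s s' /SuccNat2Pos.inj /val_inj. Qed.

Lemma id_of_surj i : in_range i -> exists s, i = id_of s.
Proof.
move=> /Pos.leb_le i_le.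
have s_lt : ((Pos.to_nat i).-1 < 307)%N by lia.
by exists (Ordinal s_lt); rewrite /id_of /=; lia.
Qed.

(** Allows functions on all identifiers to be treated as vectors with 307 entries. *)
Lemma stable_out_range j i : ~~ in_range i -> stable j i = 0.
Proof.
have /andP[kt kn] := ids_in_range; move=> iN.
rewrite /stable /zcompl /compl /zget.
case e: tget => [a|]; first by rewrite (tkeysP kt e) in iN.
case e': tget => [a|] /=; first by rewrite (tkeysP kn e') in iN.
by case: j; rewrite mulr0 subr0.
Qed.

Lemma rdot_coef f r : all (fun e => in_range e.1) r ->
  rdot f r = \sum_s coef r (id_of s) * f (id_of s).
Proof.
elim: r => [|[i c] r IHr] /= => [_|/andP[/id_of_surj[s ->] /IHr ->]].
  by rewrite big1 // => s _; rewrite mul0r.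
rewrite [RHS](bigD1 s) //= (bigD1 s) //= Pos.eqb_refl.
have -> : Z.add c (coef r (id_of s)) = c + coef r (id_of s) by [].
rewrite mulrDl -addrA; congr (_ + (_ + _)); apply: eq_bigr => s' s's.
case: Pos.eqb_spec => // /id_of_inj e; by rewrite e eqxx in s's.
Qed.

Definition ratZ : {rmorphism Z -> rat} := intr \o int_of_Z.
Definition f2Z : {rmorphism Z -> 'F_2} := intr \o int_of_Z.

Lemma ratZ_eq0 z : (ratZ z == 0) = (z == 0).
Proof.
rewrite /ratZ /= intr_eq0; apply/eqP/eqP => [e|->]; last by rewrite raddf0.
by rewrite -(int_of_ZK z) e.
Qed.

Lemma f2Z_odd z : f2Z z = (Z.odd z)%:R.
Proof.
have e : z = 2%:R * Z.div2 z + (Z.odd z)%:R.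
  by rewrite {1}(Z.div2_odd z); case: (Z.odd z).
have two : (2%:R : 'F_2) = 0 by apply/val_inj.
by rewrite [in LHS]e rmorphD rmorphM !rmorph_nat two mul0r add0r.
Qed.

(** The square submatrix on the columns [l] is, modulo 2, upper triangular with ones on the
    diagonal. Its determinant is therefore odd, hence nonzero over the rationals; parities spare an
    exact elimination. *)
Lemma rank_mod2 m n (K : 'M[Z]_(m, n)) (l : 'I_m -> 'I_n) :
  (forall i, Z.odd (K i (l i))) -> (forall i j : 'I_m, (j < i)%N -> ~~ Z.odd (K i (l j))) ->
  \rank (map_mx ratZ K) = m.
Proof.
move=> Kodd Keven; pose A := colsub l K.
have detA : \det A != 0.
  apply: contraNneq (oner_neq0 'F_2) => detA0.
  have <- : \det (map_mx f2Z A) = 1.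
    rewrite -det_tr det_trig.
      by rewrite big1 // => i _; rewrite !mxE f2Z_odd Kodd.
    apply/is_trig_mxP => i j ij.
    by rewrite !mxE f2Z_odd (negbTE (Keven _ _ ij)).
  by rewrite det_map_mx detA0 rmorph0.
have A_unit : map_mx ratZ A \in unitmx.
  by rewrite unitmxE det_map_mx unitfE ratZ_eq0.
apply/eqP; rewrite eqn_leq rank_leq_row -{1}(mxrank_unit A_unit).
have -> : map_mx ratZ A = map_mx ratZ K *m colsub l 1%:M.
  by rewrite mulmx_colsub mulmx1; apply/matrixP => i j; rewrite !mxE.
exact: mxrankM_maxl.
Qed.

(** [lam] is a left null vector of the matrix with rows v, T v, .., T^146 v, up to scaling. The
    indices are shifted by one because [stable j] at the empty profile is a multiple of a_(j+1). *)
Lemma tilings_dependence : exists2 lam : 'rV[rat]_147, lam != 0 &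
  forall m, \sum_j lam 0 j * (num_L_tilings 9 (8 * (j + m).+1))%:R = 0.
Proof.
have /andP[/eqP size_kernel in_rangeT] := kernel_in_range.
have row_in i : (i < 161)%N -> all (fun e => in_range e.1) (nth [::] kernel i).
  by move=> i_lt; apply: (all_nthP [::] in_rangeT); rewrite size_kernel.
have lead_in i : (i < 161)%N -> in_range (lead i).
  by move/row_in; rewrite /lead; case: (nth _ _ _) => //= e r /andP[].
have utri i : (i < 161)%N -> let r := nth [::] kernel i in
    Z.odd (coef r (lead i)) /\ forall j, (j < i)%N -> ~~ Z.odd (coef r (lead j)).
  move=> i_lt; have /allP/(_ i) := kernel_unitriangular.
  rewrite mem_iota => /(_ i_lt) /andP[od /allP ev]; split=> // j ji.
  by apply: ev; rewrite mem_iota.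
pose l (i : 'I_161) : 'I_307 := inord (Pos.to_nat (lead i)).-1.
have id_l i : id_of (l i) = lead i.
  have [s es] := id_of_surj (lead_in _ (ltn_ord i)).
  by rewrite /l es /id_of SuccNat2Pos.id_succ /= inord_val.
pose K : 'M[Z]_(161, 307) := \matrix_(i, s) coef (nth [::] kernel i) (id_of s).
pose G : 'M[rat]_(147, 307) := \matrix_(j, s) ratZ (stable j (id_of s)).
have rankK : \rank (map_mx ratZ K) = 161.
  apply: (@rank_mod2 _ _ _ l) => i => [|j ji]; rewrite mxE id_l;
    have [od ev] := utri _ (ltn_ord i); [exact: od | exact: ev].
have GK : G *m (map_mx ratZ K)^T = 0.
  apply/matrixP => j i; rewrite !mxE.
  have := rdot_coef (stable j) (row_in _ (ltn_ord i)).
  rewrite rdot_stable; last by apply: (all_nthP [::] kernel_okT); rewrite size_kernel.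
  move/(congr1 ratZ); rewrite rmorph0 rmorph_sum => e; rewrite [RHS]e.
  by apply: eq_bigr => s _; rewrite !mxE rmorphM mulrC.
(* The rows of [G] are orthogonal to 161 independent vectors in dimension 307, and 307 - 161 =
   146. *)
have rankG : (\rank G < 147)%N.
  by have := mulmx0_rank_max GK; rewrite mxrank_tr rankK; lia.
have /rowV0Pn[lam /sub_kermxP lamG lam0] : kermx G != 0.
  by rewrite kermx_eq0 /row_free neq_ltn rankG.
exists lam => // m.
(* The matrix gives the relation for k = 0; applying the transfer to it raises k by one. *)
have lam_stable k i : \sum_j lam 0 j * ratZ (stable (j + k) i) = 0.
  elim: k i => [|k IHk] i.
    have [/id_of_surj[s ->] | iN] := boolP (in_range i); last first.
      by rewrite big1 // => j _; rewrite stable_out_range // rmorph0 mulr0.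
    have /matrixP/(_ 0 s) := lamG; rewrite !mxE => {2}<-.
    by apply: eq_bigr => j _; rewrite mxE addn0.
  transitivity (transfer_block (fun i => \sum_j lam 0 j * ratZ (stable (j + k) i)) i).
    rewrite transfer_block_lincomb; apply: eq_bigr => j _; congr (_ * _).
    by rewrite [RHS](transfer_block_raddf ratZ) stable_step addnS.
  rewrite (eq_pullf_block IHk).
  have e0 : (fun=> 0 : rat) =1 fun _ : positive => \sum_(k < 0) (0 : rat) * 0.
    by move=> ?; rewrite big_ord0.
  by rewrite (eq_pullf_block e0) transfer_block_lincomb big_ord0.
(* The large constant is hidden behind a variable, known only to be nonzero, and then cancelled. *)
have [D D0 stableE] : exists2 D : Z, D != 0 & forall j,
    stable j 1 = D * (num_L_tilings 9 (8 * j.+1))%:R.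
  by exists nil_denom => [|j]; last exact: stable_empty.
rewrite -ratZ_eq0 in D0; apply: (mulfI D0).
rewrite mulr0 -[RHS](lam_stable m xH) mulr_sumr.
by apply: eq_bigr => j _; rewrite stableE rmorphM rmorph_nat mulrCA.
Qed.

(** * Reduction modulo 5 *)

(* The generating function modulo 5 is num5 / den5; the Bezout coefficients
   certify that the fraction is reduced. *)
Definition num5 : seq Z := [::
  1; 0; 1; 2; 1; 3; 1; 0; 1; 3; 4; 0; 3; 0; 3; 3; 4; 1; 1; 3; 0; 2; 0; 0; 4;
  3; 4; 4; 1; 2; 1; 2; 0; 2; 2; 3; 0; 2; 4; 0; 4; 3; 3; 3; 4; 2; 0; 4; 4; 1;
  4; 1; 2; 0; 4; 3; 1; 4; 2; 1; 4; 0; 2; 0; 0; 4; 2; 3; 4; 2; 4; 4; 3; 1; 0;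
  0; 3; 1; 4; 3; 0; 4; 1; 0; 0; 1; 0; 3; 4; 3; 0; 1; 0; 0; 3; 2; 2; 3; 2; 4;
  1; 4; 4; 2; 0; 0; 4; 2; 4; 2; 2; 4; 0; 2; 2; 3; 2; 1; 0; 3; 0; 3; 1; 0; 2;
  2; 3; 1; 4; 1; 1; 0; 1; 1; 4; 1; 0; 4; 1; 1; 1; 4; 2; 2; 3; 2; 3]%BZ.
Definition den5 : seq Z := [::
  1; 1; 2; 0; 1; 2; 4; 4; 4; 2; 4; 0; 4; 0; 0; 2; 1; 1; 2; 3; 2; 0; 4; 1; 1;
  4; 0; 1; 2; 2; 3; 1; 4; 1; 1; 2; 0; 3; 2; 0; 3; 0; 2; 4; 0; 3; 4; 0; 2; 4;
  4; 3; 4; 3; 2; 0; 0; 3; 0; 4; 4; 0; 2; 0; 2; 3; 4; 4; 3; 2; 0; 4; 2; 4; 0;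
  3; 3; 3; 1; 4; 4; 1; 2; 1; 2; 1; 3; 1; 4; 0; 4; 0; 4; 2; 3; 3; 2; 3; 0; 1;
  2; 4; 4; 1; 3; 2; 0; 3; 2; 4; 2; 3; 3; 0; 0; 3; 0; 2; 4; 3; 1; 2; 3; 2; 2;
  1; 1; 1; 2; 1; 2; 1; 2; 3; 1; 0; 4; 3; 0; 3; 2; 4; 3; 3; 2; 3; 1]%BZ.
Definition bezout_num5 : seq Z := [::
  3; 0; 4; 1; 1; 1; 4; 3; 0; 2; 2; 2; 4; 1; 4; 3; 1; 1; 4; 0; 3; 2; 3; 2; 0;
  4; 1; 4; 1; 3; 0; 2; 2; 0; 3; 4; 0; 4; 4; 2; 2; 2; 0; 0; 2; 0; 4; 3; 0; 0;
  4; 1; 4; 4; 4; 3; 4; 0; 2; 1; 3; 2; 4; 4; 2; 4; 3; 2; 1; 0; 4; 1; 0; 2; 0;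
  4; 4; 3; 0; 2; 2; 4; 2; 3; 0; 1; 1; 0; 0; 2; 3; 1; 3; 2; 2; 0; 3; 3; 3; 4;
  4; 2; 0; 0; 4; 2; 0; 4; 2; 1; 4; 0; 1; 1; 0; 3; 0; 0; 0; 1; 1; 3; 3; 1; 4;
  1; 3; 2; 4; 3; 1; 1; 4; 1; 1; 0; 3; 2; 0; 1; 1; 0; 4; 4; 1; 2]%BZ.
Definition bezout_den5 : seq Z := [::
  3; 2; 0; 4; 0; 0; 0; 2; 3; 1; 4; 0; 3; 3; 3; 4; 3; 4; 1; 3; 4; 4; 4; 2; 1;
  3; 3; 2; 3; 4; 4; 3; 4; 1; 0; 0; 1; 4; 1; 4; 3; 4; 2; 2; 1; 3; 2; 0; 3; 2;
  4; 4; 4; 2; 3; 0; 1; 1; 3; 1; 1; 4; 0; 3; 2; 4; 0; 4; 3; 0; 2; 3; 4; 0; 4;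
  3; 3; 1; 4; 4; 1; 1; 1; 3; 2; 1; 3; 3; 1; 0; 0; 4; 3; 1; 0; 2; 2; 3; 4; 0;
  2; 3; 0; 0; 1; 1; 4; 3; 0; 4; 4; 3; 4; 2; 2; 1; 3; 3; 2; 3; 1; 1; 1; 1; 4;
  1; 0; 0; 0; 2; 0; 0; 4; 0; 4; 1; 4; 1; 2; 2; 2; 0; 2; 4; 1; 4]%BZ.

Fixpoint padd (p q : seq Z) : seq Z :=
  match p, q with
  | [::], _ => q
  | _, [::] => p
  | a :: p, b :: q => Z.add a b :: padd p q
  end.

Fixpoint pmul (p q : seq Z) : seq Z :=
  if p is a :: p then padd (map (Z.mul a) q) (Z0 :: pmul p q) else [::].

Definition eq_mod5 (p q : seq Z) : bool :=
  all (fun a => Z.eqb (Z.modulo a 5) Z0) (padd p (map Z.opp q)).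

(** 293 = 2 * 146 + 1: after cross-multiplication, two fractions with terms of degree at most 146
    differ by a polynomial of degree at most 292. *)
Definition vals5 : seq Z := vals (fun z => Z.modulo z 5) 293 start.

Lemma vals5_check : eq_mod5 (take 293 (pmul den5 vals5)) num5 = true.
Proof. vm_cast_no_check (erefl true). Qed.

Lemma bezout_check :
  eq_mod5 (padd (pmul bezout_num5 num5) (pmul bezout_den5 den5)) [:: Zpos 1] = true.
Proof. vm_cast_no_check (erefl true). Qed.

(** * From lists of integers to polynomials over F_5 *)

Definition f5Z : {rmorphism Z -> 'F_5} := intr \o int_of_Z.

Lemma f5Z0 : f5Z Z0 = 0. Proof. exact: (rmorph0 f5Z). Qed.

Lemma f5Z_mod z : f5Z (Z.modulo z 5) = f5Z z.
Proof.
have e : z = 5%:R * Z.div z 5 + Z.modulo z 5.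
  exact: (Z.div_mod z 5).
have five : (5%:R : 'F_5) = 0 by apply/val_inj.
by rewrite [in RHS]e rmorphD rmorphM rmorph_nat five mul0r add0r.
Qed.

Definition poly5 (s : seq Z) : {poly 'F_5} := Poly (map f5Z s).

Lemma poly5_cons a s : poly5 (a :: s) = poly5 s * 'X + (f5Z a)%:P.
Proof. by rewrite /poly5 /= cons_poly_def. Qed.

Lemma poly5_add p q : poly5 (padd p q) = poly5 p + poly5 q.
Proof.
elim: p q => [|a p IHp] [|b q]; rewrite ?add0r ?addr0 //=.
rewrite !poly5_cons IHp -[Z.add a b]/(a + b) rmorphD polyCD; ring.
Qed.

Lemma poly5_scale a p : poly5 (map (Z.mul a) p) = (f5Z a)%:P * poly5 p.
Proof.
elim: p => [|b p IHp] /=; first by rewrite mulr0.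
rewrite !poly5_cons IHp -[Z.mul a b]/(a * b) rmorphM polyCM; ring.
Qed.

Lemma poly5_mul p q : poly5 (pmul p q) = poly5 p * poly5 q.
Proof.
elim: p => [|a p IHp] /=; first by rewrite mul0r.
rewrite poly5_add poly5_scale !poly5_cons IHp f5Z0 polyC0; ring.
Qed.

Lemma eq_mod5P p q : eq_mod5 p q -> poly5 p = poly5 q.
Proof.
have poly5_0 s : all (fun a => Z.eqb (Z.modulo a 5) Z0) s -> poly5 s = 0.
  elim: s => //= a s IHs /andP[/Z.eqb_eq a0 /IHs s0].
  by rewrite poly5_cons s0 -f5Z_mod a0 f5Z0 polyC0 mul0r addr0.
move/poly5_0; rewrite poly5_add.
have -> : map Z.opp q = map (Z.mul (-1)%R) q.
  by apply: eq_map => z; rewrite -[RHS]/(-1 * z) mulN1r.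
by rewrite poly5_scale (rmorphN1 f5Z) polyCN mulN1r => /subr0_eq.
Qed.

Lemma size_poly5 s : f5Z (last Z0 s) != 0 -> size (poly5 s) = size s.
Proof.
move=> s0; rewrite /poly5 (PolyK (c := f5Z Z0)) ?size_map //.
by rewrite last_map.
Qed.

Definition tiling_poly5 : {poly 'F_5} := poly5 vals5.

Lemma tiling_poly5_coef i : (i < 293)%N ->
  tiling_poly5`_i = (num_L_tilings 9 (8 * i))%:R.
Proof.
move=> i_lt; rewrite coef_Poly (valsE (h := f5Z)) ?rmorph1 //; last exact: f5Z_mod.
by rewrite (nth_map 0%N) ?size_iota // nth_iota.
Qed.

Lemma den5_tiling i : (i < 293)%N -> (poly5 den5 * tiling_poly5)`_i = (poly5 num5)`_i.
Proof.
move=> i_lt; rewrite -poly5_mul -(eq_mod5P vals5_check) !coef_Poly.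
by rewrite map_take nth_take.
Qed.

Lemma bezout5 :
  poly5 bezout_num5 * poly5 num5 + poly5 bezout_den5 * poly5 den5 = 1.
Proof.
rewrite -!poly5_mul -poly5_add (eq_mod5P bezout_check) poly5_cons.
by rewrite [poly5 [::]]/= mul0r add0r rmorph1.
Qed.

Lemma size_num5 : size (poly5 num5) = 147.
Proof. by rewrite size_poly5. Qed.

Lemma size_den5 : size (poly5 den5) = 147.
Proof. by rewrite size_poly5. Qed.

Lemma den5_0 : (poly5 den5)`_0 != 0.
Proof. by rewrite coef_Poly. Qed.

(** * An integral denominator that survives modulo 5 *)

Lemma primitive_denominator : exists b : {poly int},
  [/\ (size b <= 147)%N, map_poly (intr : int -> 'F_5) b != 0 &
      forall n, (147 <= n)%N ->
        \sum_(i < 147) b`_i * (num_L_tilings 9 (8 * (n - i)))%:R = 0].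
Proof.
have [lam lam0 lam_rec] := tilings_dependence.
(* Reversing [lam] turns the relation among a_(m+1), .., a_(m+147) into the vanishing of the
   coefficient of t^n, n = m + 147, in the product with the series. As a_0 takes no part, n starts
   at 147 and the numerator may reach degree 146. *)
pose p : {poly rat} := \poly_(i < 147) lam 0 (rev_ord (inord i)).
have p_coef (i : 'I_147) : p`_i = lam 0 (rev_ord i).
  by rewrite coef_poly ltn_ord inord_val.
have p0 : p != 0.
  apply: contraNneq lam0 => p0; apply/eqP/matrixP => k j.
  by rewrite ord1 -(rev_ordK j) -p_coef p0 coef0 mxE.
have [q [a a0 pE]] := rat_poly_scale p.
have q0 : q != 0 by apply: contraNneq p0 => q0; rewrite pE q0 rmorph0 scaler0.
pose b := zprimitive q.
have [c c0 bE] : exists2 c : rat, c != 0 & forall i, p`_i = c * (b`_i)%:~R.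
  exists (a%:~R^-1 * (zcontents q)%:~R) => [|i].
    by rewrite mulf_neq0 ?invr_eq0 ?intr_eq0 ?zcontents_eq0.
  by rewrite pE {1}[q]zpolyEprim coefZ coef_map coefZ /= intrM mulrA.
exists b; split.
- apply/leq_sizeP => i i_ge; apply/eqP.
  have : c * (b`_i)%:~R == 0 by rewrite -bE coef_poly ltnNge i_ge.
  by rewrite mulf_eq0 (negbTE c0) intr_eq0.
(* Otherwise 5 would divide the contents of a primitive polynomial, which are 1. *)
- apply/eqP => b0.
  have: (5 %| zcontents b)%Z.
    rewrite dvdz_contents; apply/polyOverP => i.
    rewrite (@dvdz_pcharf 'F_5 5) ?pchar_Fp //.
    by rewrite -coef_map /= b0 coef0.
  by rewrite zcontents_primitive q0.
move=> n n_ge; apply/eqP; rewrite -(intr_eq0 rat) rmorph_sum /=.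
rewrite -(mulrI_eq0 _ (mulfI c0)) mulr_sumr -[X in _ == X](lam_rec (n - 147)%N).
apply/eqP; rewrite (reindex_inj rev_ord_inj); apply: eq_bigr => i _.
rewrite rmorphM rmorph_nat mulrA -bE p_coef rev_ordK.
congr (_ * (num_L_tilings 9 (8 * _))%:R) => /=.
by have := ltn_ord i; lia.
Qed.

(** * First terms and conclusion *)

Lemma first_values : vals id 7 start =
  map Z.of_N [:: 1; 114; 42305; 17416144; 7258193991;
                 3032714594518; 1267783654718834]%num.
Proof. vm_cast_no_check (erefl (vals id 7 start)). Qed.

Lemma natrZ_map_inj (s t : seq nat) :
  map (fun n => n%:R : Z) s = map (fun n => n%:R : Z) t -> s = t.
Proof. by apply: inj_map => m n /eqP; rewrite eqr_nat => /eqP. Qed.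

Lemma Z_of_N_natr c : Z.of_N c = (nat_of_bin c)%:R.
Proof.
rewrite -{1}(nat_of_binK c).
by elim: (nat_of_bin c) => // n IHn; rewrite mulrS -IHn; lia.
Qed.

Lemma first_terms (L : seq N) m : vals id m start = map Z.of_N L ->
  [seq num_L_tilings 9 (8 * n) | n <- iota 0 m] = [seq nat_of_bin c | c <- L].
Proof.
move=> valsL; apply: natrZ_map_inj; rewrite -!map_comp -(eq_map Z_of_N_natr) -valsL.
by rewrite -[RHS]map_id (valsE (h := idfun)).
Qed.

Theorem proposition10 :
  (exists A B : {poly rat},
     [/\ size A = 147%N, size B = 147%N &
         fps_is_quotient (fun n => (num_L_tilings 9 (8 * n))%:R) (- A) B]) /\
  [seq num_L_tilings 9 (8 * n) | n <- iota 0 7] =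
  [seq nat_of_bin c | c <- [:: 1; 114; 42305; 17416144; 7258193991;
                               3032714594518; 1267783654718834]%num].
Proof.
split; last first.
  exact: (first_terms first_values).
pose a n : nat := num_L_tilings 9 (8 * n).
have [b [b_size b5 b_rec]] := primitive_denominator.
pose prod (n : nat) : int := \sum_(i < n.+1) b`_i * (a (n - i)%N)%:R.
have prod0 n : (147 <= n)%N -> prod n = 0.
  move=> n_ge; rewrite -[RHS](b_rec n n_ge) /prod.
  rewrite [RHS](@big_ord_widen _ _ _ 147 n.+1 (fun i => b`_i * (a (n - i)%N)%:R)); last by lia.
  rewrite [RHS]big_mkcond; apply: eq_bigr => i _.
  by case: ltnP => // i_ge; rewrite (leq_sizeP _ _ b_size) ?mul0r.
(* By [prod0] this truncation is the entire product of [b] with the series. *)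
pose num : {poly int} := \poly_(n < 147) prod n.
pose bF := map_poly (intr : int -> 'F_5) b; pose numF := map_poly (intr : int -> 'F_5) num.
have prodF n : (prod n)%:~R = \sum_(i < n.+1) bF`_i * (a (n - i)%N)%:R :> 'F_5.
  rewrite /prod rmorph_sum; apply: eq_bigr => i _.
  by rewrite rmorphM rmorph_nat coef_map.
have num_coef n : num`_n = prod n.
  by rewrite coef_poly; case: ltnP => // n_ge; rewrite prod0.
have bF_size : (size bF <= 147)%N by apply: leq_trans b_size; apply: size_poly.
have numF_size : (size numF <= 147)%N.
  exact: leq_trans (size_poly _ _) (size_poly _ _).
have bF_tiling n : (n < 293)%N -> (bF * tiling_poly5)`_n = numF`_n.
  move=> n_lt; have -> : numF`_n = (prod n)%:~R by rewrite -num_coef coef_map.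
  rewrite coefM prodF; apply: eq_bigr => i _.
  by rewrite tiling_poly5_coef //; lia.
have eq_low (p q r : {poly 'F_5}) n :
    (forall k, (k <= n)%N -> q`_k = r`_k) -> (p * q)`_n = (p * r)`_n.
  by move=> qr; rewrite !coefM; apply: eq_bigr => i _; rewrite qr ?leq_subr.
(* Both sides have degree at most 292, and below t^293 both agree with the product of [bF], [den5]
   and the series. *)
have numF_eq : bF * poly5 num5 = poly5 den5 * numF.
  apply/polyP => n; have [n_lt | n_ge] := ltnP n 293; last first.
    have size_le (p q : {poly 'F_5}) : (size p <= 147)%N -> (size q <= 147)%N ->
        (p * q)`_n = 0.
      move=> sp sq; apply/(leq_sizeP _ n) => //.
      by apply: leq_trans (size_polyMleq _ _) _; lia.
    by rewrite !size_le ?size_num5 ?size_den5.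
  rewrite -(eq_low _ (poly5 den5 * tiling_poly5)); last first.
    by move=> k kn; apply: den5_tiling; lia.
  rewrite mulrCA (eq_low _ _ numF) // => k kn; apply: bF_tiling; lia.
(* Multiplying the Bezout identity by [bF] and replacing [bF * num5] by [den5 * numF] exhibits [bF]
   as [den5 * w]; comparing degrees, [w] is a nonzero constant. *)
pose w := poly5 bezout_num5 * numF + poly5 bezout_den5 * bF.
have bF_w : bF = poly5 den5 * w.
  rewrite -[LHS]mulr1 -bezout5 /w mulrDr mulrCA numF_eq; ring.
have w0 : w != 0 by apply: contraNneq b5 => w0; rewrite -/bF bF_w w0 mulr0.
have den5_neq0 : poly5 den5 != 0 by rewrite -size_poly_eq0 size_den5.
have [k k0 wE] : exists2 k, k != 0 & w = k%:P.
  have size_w : size w = 1.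
    apply/eqP; rewrite eqn_leq size_poly_gt0 w0 andbT.
    have := size_mul den5_neq0 w0; rewrite -bF_w size_den5 => sE.
    by move: bF_size; rewrite sE; case: (size _) => [|[|s]] //; rewrite addnS ltnS; lia.
  have /size_poly1P[k k0 wE] : size w == 1 by rewrite size_w.
  by exists k.
have bFE : bF = k *: poly5 den5 by rewrite bF_w wE mulrC mul_polyC.
have numFE : numF = k *: poly5 num5.
  apply: (mulfI den5_neq0); by rewrite -numF_eq bFE -scalerAl -scalerAr.
have coef_neq0 (p : {poly int}) n : (map_poly (intr : int -> 'F_5) p)`_n != 0 -> p`_n != 0.
  by rewrite coef_map; apply: contraNneq => ->.
have top_neq0 (p : {poly 'F_5}) : size p = 147 -> p`_146 != 0.
  move=> sp; have := lead_coef_eq0 p; rewrite /lead_coef sp => ->.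
  by rewrite -size_poly_eq0 sp.
have size_rat (p : {poly int}) : (size p <= 147)%N -> p`_146 != 0 ->
    size (map_poly intr p : {poly rat}) = 147.
  move=> sp p146; rewrite size_map_inj_poly //; last exact: intr_inj.
  by apply/eqP; rewrite eqn_leq sp ltnNge; apply: contra p146 => /leq_sizeP ->.
(* A coefficient that is nonzero modulo 5 is nonzero, so the degrees and the constant term of the
   denominator lift from F_5. *)
have num146 : num`_146 != 0.
  by apply: coef_neq0; rewrite -/numF numFE coefZ mulf_neq0 // top_neq0 // size_num5.
have b146 : b`_146 != 0.
  by apply: coef_neq0; rewrite -/bF bFE coefZ mulf_neq0 // top_neq0 // size_den5.
have b00 : b`_0 != 0 by apply: coef_neq0; rewrite -/bF bFE coefZ mulf_neq0 // den5_0.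
exists (- map_poly intr num), (map_poly intr b); split.
- by rewrite size_polyN size_rat // size_poly.
- by rewrite size_rat.
split=> [|n]; first by rewrite coef_map intr_eq0.
have -> : fps_of_poly (- - map_poly intr num) n = (prod n)%:~R.
  by rewrite opprK /fps_of_poly -num_coef coef_map.
rewrite /prod rmorph_sum; apply: eq_bigr => i _.
by rewrite rmorphM rmorph_nat /fps_of_poly coef_map.
Qed.
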